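(* Let $E$ be a real Banach space. Then the following statements are equivalent to each other: (1) $E$ is reflexive. (2) For each proper s.w.l.s.c. function $f: E\to(-\infty,+\infty]$ such that $f$ has a bounded minimizing sequence, there exists $x_0\in E$ such that $f(x_0)=\inf_{x\in E}f(x)$. (3) For each bounded nonempty sequentially weakly closed subset $A$ of $E$ and each proper s.w.l.s.c. function $f: A\to(-\infty,+\infty]$, there exists $x_0\in A$ such that $f(x_0)=\inf_{x\in A}f(x)$. (4) For each unbounded sequentially weakly closed subset $A$ of $E$ and each proper s.w.l.s.c. coercive function $f: A\to(-\infty,+\infty]$, there exists $x_0\in A$ such that $f(x_0)=\inf_{x\in A}f(x)$. (5) For each unbounded sequentially weakly closed subset $A$ of $E$ and each s.w.l.s.c. coercive function $f: A\to(-\infty,+\infty)$, there exists $x_0\in A$ such that $f(x_0)=\inf_{x\in A}f(x)$. (6) For each proper s.w.l.s.c. function $f: E\to(-\infty,+\infty]$ satisfying $f(x)\geq\varphi(\|x\|)+\beta$ for any $x\in E$, for some real number $\beta$ and some nondecreasing function $\varphi:[0,+\infty)\to[0,+\infty)$ with $\lim_{t\to+\infty}\varphi(t)=+\infty$, there exists $x_0\in E$ such that $f(x_0)=\inf_{x\in E}f(x)$. (7) For each unbounded sequentially weakly closed subset $A$ of $E$ and each s.w.l.s.c. bounded coercive function $f: A\to(-\infty,+\infty)$, there exists $x_0\in A$ such that $f(x_0)=\inf_{x\in A}f(x)$. (8) For each s.w.l.s.c. coercive Lipschitz function $f: E\to(-\infty,+\infty)$, there exists $x_0\in E$ such that $f(x_0)=\inf_{x\in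 E}f(x)$. (9) For each bounded linear functional $g$ on $E$ there exists $x_0\in E$ with $\|x_0\|\leq1$ such that $g(x_0)=\|g\|$.
   Context: All normed spaces are over $\mathbb{R}$. Let $A$ be a nonempty subset of a normed space $(E,\|\cdot\|)$ and $f: A\to(-\infty,+\infty]$ a function. - $A$ is sequentially weakly closed if the weak limit in $E$ of every weakly convergent sequence in $A$ belongs to $A$. - $f$ is proper if $f(x_0)<+\infty$ for some $x_0\in A$. - $f$ is bounded if $f(D)$ is a bounded subset of $\mathbb{R}$ for each bounded subset $D$ of $A$ (so $f$ is real-valued); this does not mean $\sup_{x\in A}|f(x)|<+\infty$. - $f$ is s.w.l.s.c. (sequentially weakly lower semicontinuous) if $\liminf_n f(x_n)\geq f(x)$ for every $x\in A$ and every sequence $(x_n)$ in $A$ converging weakly to $x$. - $f$ is coercive if $A$ is unbounded and $f(x)\to+\infty$ as $\|x\|\to+\infty$, $x\in A$. - A sequence $(x_n)_{n\in\mathbb{N}}$ in $A$ is a minimizing sequence of $f$ if $(f(x_n))_{n\in\mathbb{N}}$ converges to $\inf_{x\in A}f(x)$ in a nonincreasing manner. *)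

(* Defs.v *)
From HB Require Import structures.
From mathcomp Require Import all_boot all_order all_algebra.
From mathcomp Require Import all_classical all_reals all_analysis.

Set Implicit Arguments.
Unset Strict Implicit.
Unset Printing Implicit Defensive.

Import Order.TTheory GRing.Theory Num.Theory.
Import numFieldNormedType.Exports.

Local Open Scope classical_set_scope.
Local Open Scope ring_scope.

Section dual.
Context {R : realType} (E : normedModType R).

Definition bounded_linear_functional : {pred E -> R^o} :=
  [pred g : E -> R^o |
    `[< linear g /\ exists M : R, forall x, `|g x| <= M * `|x| >]].

Lemma bounded_linear_functionalP (g : E -> R^o) :
  reflect (linear g /\ exists M : R, forall x, `|g x| <= M * `|x|)
          (g \in bounded_linear_functional).
Proof. exact: asboolP. Qed.

Record dual := Dual {
  dual_fun :> E -> R^o;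
  _ : dual_fun \in bounded_linear_functional }.

HB.instance Definition _ := [isSub for dual_fun].
HB.instance Definition _ := [Choice of dual by <:].

Lemma bounded_linear_functional_submod_closed :
  submod_closed bounded_linear_functional.
Proof.
split=> [|a g h].
  apply/bounded_linear_functionalP; split=> [a x y|].
    by change (0 = a *: (0 : R^o) + (0 : R^o)); rewrite scaler0 addr0.
  exists 0 => x; change (`|0 : R^o| <= 0 * `|x|).
  by rewrite normr0 mul0r.
move=> /bounded_linear_functionalP[lg [M gM]].
move=> /bounded_linear_functionalP[lh [N hN]].
apply/bounded_linear_functionalP; split.
  move=> b x y; change (a *: g (b *: x + y) + h (b *: x + y) =
    b *: (a *: g x + h x) + (a *: g y + h y)).
  rewrite lg lh !scalerDr !scalerA (mulrC a b) -!addrA; congr (_ + _).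
  by rewrite addrCA.
exists (`|a| * M + N) => x; change (`|a *: g x + h x| <= (`|a| * M + N) * `|x|).
rewrite (le_trans (ler_normD _ _))// mulrDl lerD// normrZ -mulrA.
exact: ler_wpM2l.
Qed.

HB.instance Definition _ := GRing.isSubmodClosed.Build _ _
  bounded_linear_functional bounded_linear_functional_submod_closed.
HB.instance Definition _ := [SubChoice_isSubLmodule of dual by <:].

Lemma dual_linear (g : dual) : linear (g : E -> R^o).
Proof. by case: g => g /= /bounded_linear_functionalP[]. Qed.

HB.instance Definition _ (g : dual) :=
  GRing.isLinear.Build R E R^o *:%R (dual_fun g) (dual_linear g).

Lemma dual_bounded (g : dual) : exists M : R, forall x, `|g x| <= M * `|x|.
Proof. by case: g => g /= /bounded_linear_functionalP[]. Qed.

Definition opnorm (g : dual) : R := sup [set `|g x| | x in [set x | `|x| <= 1]].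

Lemma opnorm_has_sup (g : dual) :
  has_sup [set `|g x| | x in [set x | `|x| <= 1]].
Proof.
split; first by exists `|g 0|, 0 => //=; rewrite normr0.
have [M gM] := dual_bounded g.
exists `|M| => _ [x /= x1 <-]; apply: (le_trans (gM x)).
apply: (@le_trans _ _ (`|M| * `|x|)); first by rewrite ler_wpM2r ?ler_norm.
by rewrite ler_piMr.
Qed.

Lemma le_opnorm1 (g : dual) (x : E) : `|x| <= 1 -> `|g x| <= opnorm g.
Proof. by move=> x1; apply: sup_upper_bound (opnorm_has_sup g) _ _; exists x. Qed.

Lemma opnorm_le (g : dual) (M : R) :
  (forall x, `|x| <= 1 -> `|g x| <= M) -> opnorm g <= M.
Proof.
move=> gM; apply: ge_sup; first by case: (opnorm_has_sup g).
by move=> _ [x /= x1 <-]; exact: gM.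
Qed.

Lemma opnorm_ge0 (g : dual) : 0 <= opnorm g.
Proof. by apply: le_trans (le_opnorm1 g (x := 0) _); rewrite ?normr0. Qed.

Lemma le_opnorm (g : dual) (x : E) : `|g x| <= opnorm g * `|x|.
Proof.
have [->|x0] := eqVneq x 0; first by rewrite linear0 !normr0 mulr0.
have nx : 0 < `|x| by rewrite normr_gt0.
have := @le_opnorm1 g (`|x|^-1 *: x).
rewrite normrZ normfV normr_id mulVf ?normr_eq0// => /(_ (lexx _)).
by rewrite linearZ/= normrZ normfV normr_id ler_pdivrMl// mulrC.
Qed.

Lemma opnormD (g h : dual) : opnorm (g + h) <= opnorm g + opnorm h.
Proof.
apply: opnorm_le => x x1; change (`|g x + h x| <= opnorm g + opnorm h).
by rewrite (le_trans (ler_normD _ _))// lerD// le_opnorm1.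
Qed.

Let opnormZ_le (a : R) (g : dual) : opnorm (a *: g) <= `|a| * opnorm g.
Proof.
apply: opnorm_le => x x1; change (`|a *: g x| <= `|a| * opnorm g).
by rewrite normrZ ler_wpM2l// le_opnorm1.
Qed.

Lemma opnormZ (a : R) (g : dual) : opnorm (a *: g) = `|a| * opnorm g.
Proof.
have [->|a0] := eqVneq a 0.
  apply/eqP; rewrite eq_le opnormZ_le/= normr0 mul0r; exact: opnorm_ge0.
apply/eqP; rewrite eq_le opnormZ_le/= -ler_pdivlMl ?normr_gt0//.
by rewrite -normfV (le_trans _ (opnormZ_le _ _))// scalerA mulVf// scale1r.
Qed.

Lemma opnorm_eq0 (g : dual) : opnorm g = 0 -> g = 0.
Proof.
move=> g0; apply: val_inj; apply/funext => x.
change (g x = 0); apply/eqP.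
by rewrite -normr_le0 (le_trans (le_opnorm _ _))// g0 mul0r.
Qed.

HB.instance Definition _ :=
  Lmodule_isNormed.Build R dual opnormD opnormZ opnorm_eq0.

Lemma dual_normE (g : dual) :
  `|g| = sup [set `|g x| | x in [set x | `|x| <= 1]].
Proof. by []. Qed.

End dual.

Definition reflexive_space {R : realType} (E : normedModType R) :=
  forall Phi : dual (dual E), exists x : E, forall g : dual E, Phi g = g x.

Definition weak_cvg {R : realType} {E : normedModType R}
    (u : nat -> E) (x : E) :=
  forall g : dual E, g (u n) @[n --> \oo] --> g x.

Definition seq_weakly_closed {R : realType} {E : normedModType R}
    (A : set E) :=
  forall (u : nat -> E) (x : E), (forall n, A (u n)) -> weak_cvg u x -> A x.

(* A function on [A] is represented by a total function on [E]; the notions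
   below only involve its values on [A]. Real-valued functions are passed as
   [EFin \o f]. *)
Section functions_on.
Context {R : realType} {E : normedModType R}.
Implicit Types (A : set E) (f : E -> \bar R) (u : nat -> E).

Definition proper_on A f :=
  (forall x, A x -> (-oo < f x)%E) /\ (exists2 x0, A x0 & (f x0 < +oo)%E).

Definition swlsc_on A f :=
  forall u x, A x -> (forall n, A (u n)) -> weak_cvg u x ->
    (f x <= limn_einf (f \o u))%E.

Definition coercive_on A f :=
  ~ bounded_set A /\
  forall M : R, exists r : R, forall x, A x -> r <= `|x| -> (M%:E <= f x)%E.

Definition minimizing_seq_on A f u :=
  [/\ forall n, A (u n), nonincreasing_seq (f \o u) &
      (f \o u) n @[n --> \oo] --> ereal_inf (f @` A)].

Definition attains_inf_on A f :=
  exists2 x0, A x0 & f x0 = ereal_inf (f @` A).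

(* Boundedness on bounded subsets, not boundedness of the range. *)
Definition bounded_on (A : set E) (f : E -> R) :=
  forall D : set E, D `<=` A -> bounded_set D -> bounded_set (f @` D).

End functions_on.

(* Main.v *)
Require Import Defs.
From mathcomp Require Import all_boot all_order all_algebra.
From mathcomp Require Import all_classical all_reals all_analysis.
From mathcomp Require Import ring lra.
Import Order.TTheory GRing.Theory Num.Theory.
Import numFieldNormedType.Exports.
Local Open Scope classical_set_scope.
Local Open Scope ring_scope.

Set Implicit Arguments.
Unset Strict Implicit.
Unset Printing Implicit Defensive.

(** Each of (2)-(8) is a Weierstrass principle, and reflexivity gives all of
    them for one reason: in a reflexive space every bounded sequence has a
    weakly convergent subsequence ([reflexive_weak_subseq]), so a bounded
    minimizing sequence has a weak cluster point, where sequential weak lower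
    semicontinuity makes the function minimal ([bounded_minimizing_attains]).
    Coercivity only serves to bound minimizing sequences
    ([coercive_attains]).

    Conversely, one family of test functions recovers (9) from every item: for
    a functional [g], the function
    [- g x + (`|g| + 1) * max (`|x| - 1) 0] is Lipschitz, coercive, a maximum
    of affine functions with continuous slopes (hence sequentially weakly lower
    semicontinuous), and outside the unit ball the penalty makes it larger than
    its infimum [- `|g|]; so a minimizer is a point of the unit ball where [g]
    attains its norm ([penalized_attains]).

    The deep implication is (9) => (1), James' theorem.  In a non-reflexive
    space a functional [Phi] of the bidual lies at positive distance from the
    space, and Helly's theorem yields points [x m] of the unit ball and
    functionals [g k] of norm at most 1 such that [g k (x m)] is at least
    [2 theta] for [k <= m] and at most [theta] for [m < k]
    ([separating_sequences]).  Hence a convex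
    combination of the [g k] stays [theta] above the late [g k] at some [x m].
    From these one builds functionals [h n] by successive near-minimization:
    with [s n] the sum of [2^-(i+1) h i] over [i < n], the next [h n], together
    with a sequence [G n.+1] of functionals in the convex closures of the tails
    of [G n], almost minimizes the supremum over the unit ball of
    [s n + 2^-n h n - liminf G n.+1].  If [w] is a weak-star cluster point of
    [h] and [f] the sum of the series, a point [z] of the unit ball where
    [f - w] attained its norm would force [h n z] to converge to a limit
    exceeding [w z]: this is Simons' convexity argument, and it contradicts the
    choice of [w] ([james_functional]).  Passing to tails at every stage is
    Pryce's device for doing without weak-star sequential compactness.

    The Hahn-Banach theorem behind all this is obtained from Zorn's lemma
    through minimal sublinear functionals. *)

(** * The Hahn-Banach theorem *)

Section sublinear_functionals.
Variables (R : realType) (V : lmodType R).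
Implicit Types (p q : V -> R) (x y : V).

Definition sublinear p :=
  (forall x y, p (x + y) <= p x + p y) /\
  (forall t x, 0 < t -> p (t *: x) <= t * p x).

Lemma sublinear0 p : sublinear p -> p 0 = 0.
Proof.
move=> [pD pZ].
have h1 := pZ 2 0 (ltr0Sn _ _); have h2 := pZ 2^-1 0 ltac:(by lra).
rewrite !scaler0 in h1 h2; lra.
Qed.

Lemma sublinearN p x : sublinear p -> - p (- x) <= p x.
Proof.
by move=> sp; have := sp.1 x (- x); rewrite subrr sublinear0//; lra.
Qed.

Lemma sublinearZ p t x : sublinear p -> 0 <= t -> p (t *: x) = t * p x.
Proof.
move=> sp; rewrite le_eqVlt => /predU1P[<-|t0].
  by rewrite scale0r mul0r sublinear0.
apply/eqP; rewrite eq_le sp.2//=.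
have ti : 0 < t^-1 by rewrite invr_gt0.
have := sp.2 t^-1 (t *: x) ti.
by rewrite scalerA mulVf ?gt_eqF// scale1r ler_pdivlMl.
Qed.

(** Along a chain two competitors [q1], [q2] can be replaced by the smaller one,
    which is why the pointwise infimum stays subadditive; it is finite because
    each [q] is bounded below by [x |-> - p (- x)]. *)
Lemma sublinear_chain_inf p (A : set (V -> R)) : sublinear p ->
  (forall q, A q -> sublinear q /\ (forall x, q x <= p x)) -> A !=set0 ->
  (forall q q', A q -> A q' ->
    (forall x, q x <= q' x) \/ (forall x, q' x <= q x)) ->
  exists2 q0, sublinear q0 & forall q, A q -> forall x, q0 x <= q x.
Proof.
move=> sp Asub [qA AqA] Atot.
pose S x := [set q x | q in A].
have S0 x : S x !=set0 by exists (qA x), qA.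
have Slb x : has_lbound (S x).
  exists (- p (- x)) => _ [q Aq <-]; have [sq qp] := Asub _ Aq.
  by apply: le_trans (sublinearN _ sq); rewrite lerN2.
have infS q x : A q -> inf (S x) <= q x by move=> Aq; apply: ge_inf => //; exists q.
exists (fun x => inf (S x)); last by move=> q Aq x; exact: infS.
split=> [x y|t x t0].
  rewrite -lerBlDl; apply: lb_le_inf => // _ [q2 Aq2 <-].
  rewrite lerBlDl -lerBlDr; apply: lb_le_inf => // _ [q1 Aq1 <-].
  rewrite lerBlDr.
  case: (Atot _ _ Aq1 Aq2) => q12.
    apply: le_trans (infS _ _ Aq1) _; apply: le_trans ((Asub _ Aq1).1.1 _ _) _.
    by rewrite lerD.
  apply: le_trans (infS _ _ Aq2) _; apply: le_trans ((Asub _ Aq2).1.1 _ _) _.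
  by rewrite lerD.
rewrite -ler_pdivrMl//; apply: lb_le_inf => // _ [q Aq <-].
by rewrite ler_pdivrMl// -(sublinearZ x (Asub _ Aq).1 (ltW t0)); exact: infS.
Qed.

Lemma minimal_sublinear p : sublinear p ->
  exists q, [/\ sublinear q, forall x, q x <= p x &
    forall q', sublinear q' -> (forall x, q' x <= q x) -> forall x, q' x = q x].
Proof.
move=> sp; pose T := {q : V -> R | sublinear q /\ (forall x, q x <= p x)}.
pose Rl (a b : T) := `[< forall x, sval b x <= sval a x >].
have t0 : T by exists p.
have [//| | | [q [sq qp]] qmax] := @ZL_preorder T t0 Rl.
- by move=> a; apply/asboolP.
- move=> b a c /asboolP ab /asboolP bc; apply/asboolP => x.
  exact: le_trans (bc x) (ab x).
- move=> A Atot; have [A0|A0] := pselect (A !=set0); last first.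
    by exists t0 => s As; exfalso; apply: A0; exists s.
  have [q0 sq0 q0A] : exists2 q0, sublinear q0 &
      forall q, [set sval a | a in A] q -> forall x, q0 x <= q x.
    apply: (sublinear_chain_inf sp) => [_ [a Aa <-]||_ _ [a Aa <-] [b Ab <-]].
    - exact: (proj2_sig a).
    - by case: A0 => a Aa; exists (sval a), a.
    - by have [/asboolP|/asboolP] := Atot _ _ Aa Ab; [right|left].
  have q0p : forall x, q0 x <= p x.
    case: A0 => a Aa x.
    apply: le_trans ((proj2_sig a).2 x); apply: q0A; by exists a.
  exists (exist _ q0 (conj sq0 q0p)) => s As; apply/asboolP => x /=.
  by apply: q0A; exists s.
exists q; split=> // q' sq' q'q x.
have q'p y : q' y <= p y := le_trans (q'q y) (qp y).
have /asboolP/= h := qmax (exist _ q' (conj sq' q'p)) ltac:(exact/asboolP).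
by apply/eqP; rewrite eq_le q'q h.
Qed.

(* Lowering [q] this way keeps it sublinear, so a minimal [q] is unchanged;
   taking [t = 1] then gives [q x + q y <= q (x + y)]. *)
Let tilt q y x := inf [set q (x + t *: y) - t * q y | t in [set t | 0 <= t]].

Let tilt_le q y x t : sublinear q -> 0 <= t ->
  tilt q y x <= q (x + t *: y) - t * q y.
Proof.
move=> sq t0; apply: ge_inf; last by exists t.
exists (- q (- x)) => _ [s /= s0 <-].
rewrite -sublinearZ// lerNl opprB lerBlDr.
have -> : q (s *: y) = q (- x + (x + s *: y)) by rewrite addKr.
exact: sq.1.
Qed.

Let tilt_ge q y x c : (forall t, 0 <= t -> c <= q (x + t *: y) - t * q y) ->
  c <= tilt q y x.
Proof.
move=> h; apply: lb_le_inf => [|_ [t /= t0 <-]]; last exact: h.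
by exists (q (x + 0 *: y) - 0 * q y), 0 => /=.
Qed.

Let tilt_sublinear q y : sublinear q -> sublinear (tilt q y).
Proof.
move=> sq; split=> [x x'|s x s0].
  rewrite -lerBlDl; apply: tilt_ge => t' t'0.
  rewrite lerBlDl -lerBlDr; apply: tilt_ge => t t0; rewrite lerBlDr.
  apply: le_trans (tilt_le _ _ sq (addr_ge0 t0 t'0)) _.
  rewrite mulrDl opprD addrACA lerD2r scalerDl addrACA; exact: sq.1.
rewrite -ler_pdivrMl//; apply: tilt_ge => t t0; rewrite ler_pdivrMl//.
apply: le_trans (tilt_le y _ sq (mulr_ge0 (ltW s0) t0)) _.
rewrite mulrBr mulrA lerD2r -scalerA -scalerDr sublinearZ// ltW//.
Qed.

(** A minimal sublinear functional is linear, and tilting [p] towards [x0]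
    before minimizing forces equality at [x0]. *)
Theorem hahn_banach p x0 : sublinear p ->
  exists g : V -> R, [/\ forall x y, g (x + y) = g x + g y,
    forall a x, g (a *: x) = a * g x, forall x, g x <= p x & g x0 = p x0].
Proof.
move=> sp.
have tilt_le0 q y x : sublinear q -> tilt q y x <= q x.
  move=> sq; apply: le_trans (tilt_le y _ sq (lexx 0)) _.
  by rewrite scale0r addr0 mul0r subr0.
have [g [sg gp gmin]] := minimal_sublinear (tilt_sublinear x0 sp).
have gD x y : g (x + y) = g x + g y.
  apply/eqP; rewrite eq_le sg.1/= -lerBrDr.
  rewrite -(gmin _ (tilt_sublinear y sg)) => [|z]; last exact: tilt_le0.
  by apply: le_trans (tilt_le y _ sg ler01) _; rewrite scale1r mul1r.
have gN x : g (- x) = - g x.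
  by have := gD x (- x); rewrite subrr sublinear0//; lra.
exists g; split=> // [a x|x|].
- have [a0|a0] := leP 0 a; first exact: sublinearZ.
  rewrite -[a]opprK scaleNr gN sublinearZ ?mulNr// oppr_ge0; exact: ltW.
- by apply: le_trans (gp x) _; exact: tilt_le0.
- apply/eqP; rewrite eq_le (le_trans (gp x0) _) ?tilt_le0//=.
  have := gp (- x0); rewrite gN => h.
  have := le_trans h (tilt_le x0 (- x0) sp ler01).
  by rewrite scale1r mul1r addNr sublinear0// add0r lerN2.
Qed.

End sublinear_functionals.

(** * Continuous functionals *)

(** A functional takes values in [R^o]; landing in [R] keeps all the arithmetic
    below in a single structure. *)
Definition pairing (R : realType) (E : normedModType R) (g : dual E) (x : E)
  : R := g x.
Arguments pairing : simpl never.

Section pairing.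
Variables (R : realType) (E : normedModType R).
Implicit Types (g h : dual E) (x y : E) (a : R).

Lemma pairingDl g h x : pairing (g + h) x = pairing g x + pairing h x. Proof. by []. Qed.
Lemma pairingNl g x : pairing (- g) x = - pairing g x. Proof. by []. Qed.
Lemma pairingBl g h x : pairing (g - h) x = pairing g x - pairing h x. Proof. by []. Qed.
Lemma pairingZl a g x : pairing (a *: g) x = a * pairing g x. Proof. by []. Qed.
Lemma pairing0l x : pairing 0 x = 0. Proof. by []. Qed.
Lemma pairingDr g x y : pairing g (x + y) = pairing g x + pairing g y.
Proof. by rewrite /pairing linearD. Qed.
Lemma pairingNr g x : pairing g (- x) = - pairing g x.
Proof. by rewrite /pairing linearN. Qed.
Lemma pairingBr g x y : pairing g (x - y) = pairing g x - pairing g y.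
Proof. by rewrite /pairing linearB. Qed.
Lemma pairingZr a g x : pairing g (a *: x) = a * pairing g x.
Proof. by rewrite /pairing linearZ. Qed.
Lemma pairing0r g : pairing g 0 = 0. Proof. by rewrite /pairing linear0. Qed.

Lemma pairing_suml (I : Type) (r : seq I) (F : I -> dual E) x :
  pairing (\sum_(i <- r) F i) x = \sum_(i <- r) pairing (F i) x.
Proof.
by elim/big_rec2 : _ => [|i b a _ <-]; rewrite ?pairing0l// pairingDl.
Qed.

Lemma pairing_norm_le g x : `|pairing g x| <= `|g| * `|x|.
Proof. exact: le_opnorm. Qed.

Lemma pairing_le g x : pairing g x <= `|g| * `|x|.
Proof. exact: le_trans (ler_norm _) (pairing_norm_le g x). Qed.

Lemma pairing_norm_ball g x : `|g| <= 1 -> `|x| <= 1 -> `|pairing g x| <= 1.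
Proof.
move=> g1 x1; apply: le_trans (pairing_norm_le _ _) _.
by rewrite -[1]mulr1 ler_pM.
Qed.

Lemma dual_norm_le g a : (forall x, `|x| <= 1 -> pairing g x <= a) -> `|g| <= a.
Proof.
move=> ga; apply: opnorm_le => x x1; rewrite ler_norml.
change (- a <= pairing g x <= a).
by rewrite ga// andbT lerNl -pairingNr ga// normrN.
Qed.

Lemma dual_norm_sup g a : a < `|g| -> exists2 x, `|x| <= 1 & a < pairing g x.
Proof.
move=> ag; have [//|h] := pselect (exists2 x, `|x| <= 1 & a < pairing g x).
have : `|g| <= a; last by rewrite leNgt ag.
apply: dual_norm_le => x x1; rewrite leNgt; apply/negP => xa.
by apply: h; exists x.
Qed.

Lemma dual_of_linear (f : E -> R) (M : R) :
  (forall x y, f (x + y) = f x + f y) -> (forall a x, f (a *: x) = a * f x) ->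
  (forall x, `|f x| <= M * `|x|) -> exists g, forall x, pairing g x = f x.
Proof.
move=> fD fZ fM.
have fP : (f : E -> R^o) \in @bounded_linear_functional R E.
  apply/bounded_linear_functionalP; split; last by exists M.
  by move=> a x y; rewrite fD fZ.
by exists (Dual fP).
Qed.

Lemma hahn_banach_dual (p : E -> R) x0 :
  sublinear p -> (forall x, p x <= `|x|) ->
  exists g, [/\ `|g| <= 1, forall x, pairing g x <= p x & pairing g x0 = p x0].
Proof.
move=> sp p1; have [f [fD fZ fp fx0]] := hahn_banach x0 sp.
have fN x : f (- x) = - f x by rewrite -scaleN1r fZ mulN1r.
have [|g gE] := @dual_of_linear f 1 fD fZ.
  move=> x; rewrite mul1r ler_norml lerNl -fN.
  by rewrite !(le_trans (fp _)) // (le_trans (p1 _))// normrN.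
exists g; split=> [|x|]; rewrite ?gE//.
apply: dual_norm_le => x x1; rewrite gE.
exact: le_trans (fp _) (le_trans (p1 _) x1).
Qed.

Lemma norming_functional x : exists2 g, `|g| <= 1 & pairing g x = `|x|.
Proof.
have [|//|g [g1 _ gx]] := @hahn_banach_dual (fun y => `|y|) x; last by exists g.
by split=> [y z|t y t0]; rewrite ?ler_normD// normrZ gtr0_norm.
Qed.

(** The distance to [S] is a seminorm vanishing on [S], so a linear functional
    below it that agrees with it at [x0] does the separation. *)
Lemma separate_subspace (S : set E) x0 (e : R) :
  S 0 -> (forall x y, S x -> S y -> S (x + y)) ->
  (forall a x, S x -> S (a *: x)) ->
  0 < e -> (forall y, S y -> e <= `|x0 - y|) ->
  exists2 g, (forall y, S y -> pairing g y = 0) & 0 < pairing g x0.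
Proof.
move=> S0 SD SZ e0 Se.
pose p x := inf [set `|x - y| | y in S].
have p_le x y : S y -> p x <= `|x - y|.
  by move=> Sy; apply: ge_inf; [exists 0 => _ [z _ <-]|exists y].
have p_ge x c : (forall y, S y -> c <= `|x - y|) -> c <= p x.
  move=> h; apply: lb_le_inf; first by exists (`|x - 0|), 0.
  by move=> _ [y Sy <-]; exact: h.
have sp : sublinear p.
  split=> [x x'|t x t0].
    rewrite -lerBlDl; apply: (p_ge) => y' Sy'.
    rewrite lerBlDl -lerBlDr; apply: (p_ge) => y Sy; rewrite lerBlDr.
    apply: le_trans (p_le _ _ (SD _ _ Sy Sy')) _.
    rewrite opprD addrACA; exact: ler_normD.
  rewrite -ler_pdivrMl//; apply: (p_ge) => y Sy; rewrite ler_pdivrMl//.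
  apply: le_trans (p_le _ _ (SZ t _ Sy)) _.
  by rewrite -scalerBr normrZ gtr0_norm.
have [|g [_ gp gx]] := @hahn_banach_dual p x0 sp.
  by move=> x; have := p_le x _ S0; rewrite subr0.
have gS y : S y -> pairing g y <= 0.
  by move=> Sy; rewrite (le_trans (gp y))// (le_trans (p_le _ _ Sy))// subrr normr0.
exists g => [y Sy|]; last by rewrite gx (lt_le_trans e0)// p_ge.
apply/eqP; rewrite eq_le gS//= -oppr_le0 -pairingNr -scaleN1r; exact/gS/SZ.
Qed.

End pairing.

Section bidual.
Variables (R : realType) (E : normedModType R).
Implicit Types (g : dual E) (x : E).

Lemma bidual_embedding x :
  exists2 J : dual (dual E), (forall g, pairing J g = pairing g x) & `|J| <= `|x|.
Proof.
have [//|//|g|J JE] := @dual_of_linear _ (dual E) (fun g => pairing g x) `|x|.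
  by rewrite mulrC pairing_norm_le.
exists J => //; apply: dual_norm_le => g g1; rewrite JE.
by rewrite (le_trans (pairing_le _ _))// ler_piMl.
Qed.

End bidual.

(** * Limits of bounded sequences along an ultrafilter *)

Section ultralimits.
Variable R : realType.

Lemma ultrafilter_eventually :
  exists2 U : set_system nat, UltraFilter U & \oo `<=` U.
Proof. have [U [UU sU]] := @ultraFilterLemma nat \oo _.
by exists U. Qed.

Lemma ultralimit_bounded (U : set_system nat) (u : nat -> R) (M : R) :
  UltraFilter U -> (forall n, `|u n| <= M) ->
  exists2 l : R, u n @[n --> U] --> l & `|l| <= M.
Proof.
move=> UU uM.
have uMU : (u n @[n --> U]) `[- M, M]%classic.
  apply: (@filterE _ U) => n; rewrite /= in_itv/= -ler_norml; exact: uM.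
have [l [lM ul]] := @segment_compact R (- M) M _ _ uMU.
exists l; last by move: lM; rewrite /= in_itv/= -ler_norml.
move=> A lA; have [//|UA] := in_ultra_setVsetC (u @^-1` A) UU.
by have [x [] /(_ _)] := ul (~` A) A UA lA.
Qed.

(** This replaces the weak-star compactness of dual balls: the limits of a
    bounded sequence of functionals along one ultrafilter, taken at all points
    at once, are the values of a functional. *)
Lemma ultralimit_functional (V : normedModType R) (U : set_system nat)
    (G : nat -> dual V) (M : R) :
  UltraFilter U -> (forall n, `|G n| <= M) ->
  exists2 w : dual V, `|w| <= M &
    forall x, pairing (G n) x @[n --> U] --> pairing w x.
Proof.
move=> UU GM.
have lim_ex x : exists l : R, pairing (G n) x @[n --> U] --> l.
  have [n|l Ul _] := @ultralimit_bounded U (fun n => pairing (G n) x) (M * `|x|) UU.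
    by apply: le_trans (pairing_norm_le _ _) _; rewrite ler_wpM2r.
  by exists l.
pose f x : R := xget 0 [set l : R | pairing (G n) x @[n --> U] --> l].
have fP x : pairing (G n) x @[n --> U] --> f x.
  by rewrite /f; case: xgetP => [_ -> //|h]; have [l /h] := lim_ex x.
have fM x : `|f x| <= M * `|x|.
  apply: (cvgr_to_le (cvg_norm (fP x))); apply: filterE => n.
  by apply: le_trans (pairing_norm_le _ _) _; rewrite ler_wpM2r.
have [||//|w wE] := @dual_of_linear _ V f M.
- move=> x y; apply: (cvg_unique _ (fP (x + y))) => //.
  rewrite (_ : (fun n => _) = (fun n => pairing (G n) x + pairing (G n) y)).
    exact: cvgD.
  by apply/funext => n; rewrite pairingDr.
- move=> a x; apply: (cvg_unique _ (fP (a *: x))) => //.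
  rewrite (_ : (fun n => _) = (fun n => a * pairing (G n) x)).
    by apply: cvgM; [exact: cvg_cst|exact: fP].
  by apply/funext => n; rewrite pairingZr.
exists w => [|x]; last by rewrite wE.
have M0 : 0 <= M := le_trans (normr_ge0 _) (GM 0).
apply: dual_norm_le => x x1; rewrite wE (le_trans (ler_norm _))//.
by rewrite (le_trans (fM x))// ler_piMr.
Qed.

End ultralimits.

(** * Helly's theorem *)

Section helly.
Variables (R : realType) (V : normedModType R).

(** Otherwise the image of the unit ball under [T] stays away from [r].  The
    residual [b] of an almost nearest point [v] then separates [r] from that
    image, as moving from [v] towards [u] cannot decrease the squared distance
    by much; so the combination of the [T i] with coefficients [b] contradicts
    the hypothesis. *)
Theorem helly n (T : 'I_n -> dual V) (r : 'I_n -> R) :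
  (forall b : 'I_n -> R, \sum_i b i * r i <= `|\sum_i b i *: T i|) ->
  forall e : R, 0 < e ->
    exists2 v : V, `|v| <= 1 & forall i, `|pairing (T i) v - r i| <= e.
Proof.
move=> Tr.
pose Q v := \sum_i (r i - pairing (T i) v) ^+ 2.
pose D := [set Q v | v in [set v | `|v| <= 1]].
have Q0 v : 0 <= Q v by apply: sumr_ge0 => i _; exact: sqr_ge0.
have infQ v : `|v| <= 1 -> inf D <= Q v.
  by move=> v1; apply: ge_inf; [exists 0 => _ [z _ <-]|exists v].
have hD : has_inf D.
  by split; [exists (Q 0), 0; rewrite //= normr0|exists 0 => _ [z _ <-]].
suff D0 : inf D <= 0.
  move=> e e0; have [_ [v /= v1 <-] Qv] := inf_adherent (exprn_gt0 2 e0) hD.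
  exists v => // i; set y := pairing (T i) v.
  have yQ : (r i - y) ^+ 2 <= Q v.
    rewrite /Q (bigD1 i)//= lerDl; apply: sumr_ge0 => j _; exact: sqr_ge0.
  by rewrite ler_norml; apply/andP; split; nra.
rewrite leNgt; apply/negP; set rho := inf D => rho0.
pose M := \sum_i 4 * `|T i| ^+ 2 + 1.
have M0 : 0 < M.
  by apply: ltr_wpDl => //; apply: sumr_ge0 => i _; rewrite mulr_ge0 ?sqr_ge0.
(* A step length below 1 with [s * M <= rho / 2], so that the quadratic term
   costs less than the gap [rho]. *)
pose s := rho / (2 * M + rho).
have den0 : 0 < 2 * M + rho by lra.
have s0 : 0 < s by rewrite divr_gt0.
have sE : s * (2 * M + rho) = rho by rewrite divfK ?gt_eqF.
have s1 : s <= 1 by rewrite ler_pdivrMr// mul1r; lra.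
have sM : s * M <= rho / 2 by nra.
have [_ [v /= v1 <-] Qv] := @inf_adherent _ D (s * rho / 4) ltac:(by nra) hD.
pose b i := r i - pairing (T i) v.
have QE : Q v = \sum_i b i ^+ 2 by [].
suff : `|\sum_i b i *: T i| <= \sum_i b i * r i - rho / 2.
  by have := Tr b; lra.
apply: dual_norm_le => u u1; rewrite pairing_suml.
pose d i := pairing (T i) u - pairing (T i) v.
have dM : \sum_i d i ^+ 2 <= M.
  apply: ler_wpDr => //; apply: ler_sum => i _.
  have : `|d i| <= 2 * `|T i|.
    rewrite /d -pairingBr (le_trans (pairing_norm_le _ _))// mulrC ler_wpM2r//.
    by rewrite (le_trans (ler_normB _ _))//; lra.
  rewrite -(real_normK (num_real (d i))).
  by have := normr_ge0 (d i); have := normr_ge0 (T i); nra.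
have X : \sum_i b i * d i <= 3 * rho / 8.
  have z1 : `|v + s *: (u - v)| <= 1.
    have -> : v + s *: (u - v) = (1 - s) *: v + s *: u.
      by rewrite scalerBr scalerBl scale1r addrA addrAC.
    have h1 : `|(1 - s) *: v| <= 1 - s.
      by rewrite normrZ ger0_norm ?subr_ge0// ler_piMr// subr_ge0.
    have h2 : `|s *: u| <= s by rewrite normrZ gtr0_norm// ler_piMr// ltW.
    by rewrite (le_trans (ler_normD _ _))//; lra.
  have := infQ _ z1.
  have -> : Q (v + s *: (u - v)) =
      Q v - 2 * s * \sum_i b i * d i + s ^+ 2 * \sum_i d i ^+ 2.
    rewrite /Q !mulr_sumr -sumrB -big_split/=; apply: eq_bigr => i _.
    by rewrite pairingDr pairingZr pairingBr /b /d; ring.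
  by rewrite -/rho; nra.
have -> : \sum_i pairing (b i *: T i) u =
    \sum_i b i * r i - \sum_i b i ^+ 2 + \sum_i b i * d i.
  rewrite -sumrB -big_split/=; apply: eq_bigr => i _.
  by rewrite pairingZl /b /d; ring.
by have := infQ v v1; rewrite -/rho QE; lra.
Qed.

End helly.

(** * Two forms of dependent choice *)

Section choice_sequences.

Lemma choice_history (T : Type) (P : seq T -> T -> Prop) :
  (forall s, exists t, P s t) ->
  exists u : nat -> T, forall n, P (mkseq u n) (u n).
Proof.
move=> /choice[f fP].
pose L := fix L n := if n is m.+1 then rcons (L m) (f (L m)) else [::].
exists (fun n => f (L n)) => n.
suff -> : mkseq (fun n => f (L n)) n = L n by [].
by elim: n => [//|n IHn]; rewrite mkseqS IHn.
Qed.

Lemma choice_chain (T : Type) (I : nat -> T -> Prop)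
    (S : nat -> T -> T -> Prop) (t0 : T) :
  I 0%N t0 -> (forall n t, I n t -> exists2 t', I n.+1 t' & S n t t') ->
  exists u : nat -> T,
    [/\ u 0%N = t0, forall n, I n (u n) & forall n, S n (u n) (u n.+1)].
Proof.
move=> It0 IS.
have /choice[f fP] : forall nt : nat * T, exists t',
    I nt.1 nt.2 -> I nt.1.+1 t' /\ S nt.1 nt.2 t'.
  move=> [n t]; have [/IS[t' It' St']|nI] := pselect (I n t); first by exists t'.
  by exists t0.
pose u := fix u n := if n is m.+1 then f (m, u m) else t0.
have Iu n : I n (u n) by elim: n => [//|n /(fP (n, u n))[]].
by exists u; split=> // n; have [] := fP (n, u n) (Iu n).
Qed.

End choice_sequences.

(** * Separating sequences in a non-reflexive space *)

Section not_reflexive.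
Variables (R : realType) (E : completeNormedModType R).

(** The canonical image of a complete space in its bidual is closed; a sequence
    of points approximating [Phi] would be Cauchy by [norming_functional], and
    its limit would represent [Phi]. *)
Lemma not_reflexive_far : ~ reflexive_space E ->
  exists (Phi : dual (dual E)) (d : R),
    [/\ `|Phi| <= 1, 0 < d & forall y : E,
      exists2 g : dual E, `|g| <= 1 & d <= pairing Phi g - pairing g y].
Proof.
move=> nrefl.
have [Psi Psi_out] : exists Psi : dual (dual E), forall x : E,
    exists g : dual E, Psi g <> g x.
  apply: contrapT => h; apply: nrefl => Psi; apply: contrapT => hx.
  apply: h; exists Psi => x; apply: contrapT => hg.
  apply: hx; exists x => g; apply: contrapT => ne; apply: hg; by exists g.
pose k := (`|Psi| + 1)^-1.
have k0 : 0 < k by rewrite invr_gt0 ltr_wpDl.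
pose Phi := k *: Psi; exists Phi.
have Phi1 : `|Phi| <= 1.
  by rewrite normrZ gtr0_norm// /k mulrC ler_pdivrMr ?ltr_wpDl// mul1r; lra.
have Phi_out (x : E) : exists2 g : dual E, `|g| <= 1 &
    pairing Phi g <> pairing g x.
  have [g gP] := Psi_out (k^-1 *: x); pose a := (`|g| + 1)^-1.
  have a0 : 0 < a by rewrite invr_gt0 ltr_wpDl.
  exists (a *: g).
    by rewrite normrZ gtr0_norm// /a mulrC ler_pdivrMr ?ltr_wpDl// mul1r; lra.
  rewrite pairingZr !pairingZl => /(mulfI (lt0r_neq0 a0)) e; apply: gP.
  change (pairing Psi g = pairing g (k^-1 *: x)).
  by rewrite pairingZr -e mulKf// gt_eqF.
suff [d d0 dP] : exists2 d : R, 0 < d & forall y : E,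
    exists2 g : dual E, `|g| <= 1 & d <= pairing Phi g - pairing g y.
  by exists d.
apply: contrapT => nd.
have near_Phi (e : R) : 0 < e -> exists y : E, forall g : dual E, `|g| <= 1 ->
    `|pairing Phi g - pairing g y| <= e.
  move=> e0; apply: contrapT => ny; apply: nd; exists e => // y.
  apply: contrapT => ng; apply: ny; exists y => g g1.
  rewrite ler_norml; apply/andP; split.
    rewrite leNgt; apply/negP => lt; apply: ng; exists (- g).
      by rewrite normrN.
    by rewrite pairingNr pairingNl; lra.
  by rewrite leNgt; apply/negP => lt; apply: ng; exists g => //; lra.
have [r r0 rP] : exists2 r : nat -> R, forall n, 0 < r n &
    forall e, 0 < e -> \forall n \near \oo, r n < e.
  exists harmonic => [n|e e0]; first exact: harmonic_gt0.
  have := @cvg_harmonic R => /cvgr0_norm_lt/(_ e e0).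
  by apply: filterS => n /=; rewrite ger0_norm.
have /choice[y yP] := fun n => near_Phi _ (r0 n).
have ydist m n : `|y m - y n| <= r m + r n.
  have [g g1 <-] := norming_functional (y m - y n).
  have := yP m g g1; have := yP n g g1; rewrite !ler_norml pairingBr.
  lra.
have yc : cvg (y @ \oo).
  apply: cauchy_cvg; apply: cauchy_exP => e e0.
  have [n _ rn] := rP (e / 2) ltac:(by lra).
  exists (y n); rewrite /fmap/= -ball_normE/=.
  exists n => // m /= nm.
  by apply: (le_lt_trans (ydist _ _)); have := rn n (leqnn n); have := rn m nm; lra.
pose l : E := lim (y @ \oo).
have [g g1] := Phi_out l; apply.
apply/eqP; rewrite -subr_eq0 -normr_le0; apply/ler_addgt0Pl => e e0.
have [N1 _ rN] := rP (e / 2) ltac:(by lra).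
have [N2 _ yN] : \forall n \near \oo, `|y n - l| < e / 2.
  by have /cvgrPdistC_lt/(_ (e / 2)) := yc; apply; lra.
pose n := maxn N1 N2.
have := rN n (leq_maxl _ _); have := yN n (leq_maxr _ _).
have := yP n g g1; have := pairing_norm_le g (y n - l).
rewrite pairingBr /= addr0.
have : `|g| * `|y n - l| <= `|y n - l| by rewrite ler_piMl.
rewrite !ler_norml => h1 /andP[h2 h3] /andP[h4 h5] h6 h7.
by apply/andP; split; lra.
Qed.

End not_reflexive.

Section separating_sequences.
Variables (R : realType) (E : normedModType R).

(** The functionals and the points are chosen alternately.  Helly's theorem in
    the dual gives a [g k] that is nearly [d] at [Phi] and nearly vanishes at
    the previous points, since [Phi] is at distance at least [d] from
    their span; in the
    space itself, it gives an [x k] at which [g 0, ..., g k] take nearly the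
    values that [Phi] gives them. *)
Lemma separating_sequences (Phi : dual (dual E)) (d : R) :
  `|Phi| <= 1 -> 0 < d ->
  (forall y : E, exists2 g : dual E, `|g| <= 1 &
     d <= pairing Phi g - pairing g y) ->
  exists (x : nat -> E) (g : nat -> dual E) (theta : R),
    [/\ 0 < theta, forall m, `|x m| <= 1, forall k, `|g k| <= 1,
      forall k m, (k <= m)%N -> 2 * theta <= pairing (g k) (x m) &
      forall k m, (m < k)%N -> pairing (g k) (x m) <= theta].
Proof.
move=> Phi1 d0 Phi_far; pose theta := d / 4.
have th0 : 0 < theta by rewrite divr_gt0.
have next_g (xs : seq E) : exists g : dual E, [/\ `|g| <= 1,
    3 * theta <= pairing Phi g &
    forall i, (i < size xs)%N -> pairing g xs`_i <= theta].
  have /choice[J JE] : forall x : E, exists J : dual (dual E),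
      forall g, pairing J g = pairing g x.
    by move=> x; have [J] := bidual_embedding x; exists J.
  pose T (i : 'I_(size xs).+1) :=
    if unlift ord0 i is Some j then J xs`_j else Phi.
  pose r (i : 'I_(size xs).+1) := if unlift ord0 i is Some j then 0 else d.
  have [|g g1 gT] := @helly _ _ _ T r _ theta th0.
    move=> b; rewrite !big_ord_recl /r /T unlift_none.
    rewrite big1 ?addr0 => [|i _]; last by rewrite liftK mulr0.
    set S := (X in _ <= `|X|).
    have [b0|b0] := leP (b ord0) 0.
      by rewrite (le_trans _ (normr_ge0 _))// mulr_le0_ge0// ltW.
    pose y := - \sum_(i < size xs) (b (lift ord0 i) / b ord0) *: xs`_i.
    have [g g1 dg] := Phi_far y.
    have : pairing S g <= `|S|.
      by rewrite (le_trans (pairing_le _ _))// ler_piMr.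
    apply: le_trans.
    have -> : pairing S g = b ord0 * (pairing Phi g - pairing g y).
      rewrite /S pairingDl pairingZl mulrBr; congr (_ + _).
      rewrite pairing_suml /y pairingNr mulrN opprK.
      have -> : pairing g (\sum_(i < size xs) (b (lift ord0 i) / b ord0) *: xs`_i)
        = \sum_(i < size xs) (b (lift ord0 i) / b ord0) * pairing g xs`_i.
        elim/big_rec2 : _ => [|i u v _ <-]; first exact: pairing0r.
        by rewrite pairingDr pairingZr.
      rewrite mulr_sumr; apply: eq_bigr => i _.
      by rewrite liftK pairingZl JE; field; rewrite gt_eqF.
    by rewrite ler_wpM2l// ltW.
  exists g; split=> // [|i i_s].
    have := gT ord0; rewrite /T /r unlift_none ler_norml /theta; lra.
  have := gT (lift ord0 (Ordinal i_s)).
  by rewrite /T /r liftK JE/= subr0; exact: le_trans (ler_norm _).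
have next_x (gs : seq (dual E)) : exists2 x : E, `|x| <= 1 &
    forall i, (i < size gs)%N -> 3 * theta <= pairing Phi gs`_i ->
      2 * theta <= pairing gs`_i x.
  have [|x x1 xT] := @helly _ _ _ (fun i : 'I_(size gs) => gs`_i)
      (fun i => pairing Phi gs`_i) _ theta th0.
    move=> b.
    have -> : \sum_(i < size gs) b i * pairing Phi gs`_i =
        pairing Phi (\sum_(i < size gs) b i *: gs`_i).
      elim/big_rec2 : _ => [|i u v _ ->]; first by rewrite pairing0r.
      by rewrite pairingDr pairingZr.
    by rewrite (le_trans (pairing_le _ _))// ler_piMl.
  exists x => // i i_s; have := xT (Ordinal i_s); rewrite /= ler_norml; lra.
pose P (s : seq (dual E * E)) (t : dual E * E) :=
  [/\ `|t.1| <= 1, `|t.2| <= 1, 3 * theta <= pairing Phi t.1 &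
   [/\ forall i, (i < size s)%N -> pairing t.1 (nth (0, 0) s i).2 <= theta,
    2 * theta <= pairing t.1 t.2 &
    forall i, (i < size s)%N -> 3 * theta <= pairing Phi (nth (0, 0) s i).1 ->
      2 * theta <= pairing (nth (0, 0) s i).1 t.2]].
have [|u uP] := @choice_history _ P.
  move=> s.
  have [g [g1 gPhi gs]] := next_g [seq t.2 | t <- s].
  have [x x1 xs] := next_x (g :: [seq t.1 | t <- s]).
  exists (g, x); split=> //=; split=> [i i_s||i i_s].
  - by have := gs i; rewrite size_map (nth_map (0, 0))//; apply.
  - exact: (xs 0%N).
  - by have := xs i.+1; rewrite /= size_map (nth_map (0, 0))//; apply.
exists (fun n => (u n).2), (fun n => (u n).1), theta.
split=> // [m|k|k m|k m]; [by case: (uP m)|by case: (uP k)| |].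
  rewrite leq_eqVlt => /predU1P[<-|km]; first by case: (uP k) => _ _ _ [].
  case: (uP m) => _ _ _ [_ _ /(_ k)]; rewrite size_mkseq nth_mkseq//.
  by apply=> //; case: (uP k).
move=> mk; case: (uP k) => _ _ _ [/(_ m)].
by rewrite size_mkseq nth_mkseq// => /(_ mk).
Qed.

End separating_sequences.

(** * James' theorem *)

Section real_sequences.
Variable R : realType.

Lemma half_expr_gt0 n : 0 < (2^-1 : R) ^+ n.
Proof. by rewrite exprn_gt0// invr_gt0. Qed.

Lemma cvg_half_expr : (2^-1 : R) ^+ n @[n --> \oo] --> (0 : R).
Proof. by apply: cvg_expr; rewrite ger0_norm ?invr_ge0// invf_lt1// ltr1n. Qed.

(** Here [t i] is the average of [a i] and [t i.+1], so an upper bound of [a i]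
    by [t i] makes [t] nondecreasing, up to the summable error. *)
Lemma cvg_of_halving (a t : nat -> R) (kappa M : R) : 0 <= kappa ->
  (forall i, t i.+1 = 2 * t i - a i) ->
  (forall i, a i <= t i + 2 * kappa * 2^-1 ^+ i) -> (forall i, t i <= M) ->
  exists2 l, a i @[i --> \oo] --> l & t 0%N - 4 * kappa <= l.
Proof.
move=> k0 tE at_le tM; pose v i := t i - 4 * kappa * 2^-1 ^+ i.
have vS i : v i <= v i.+1.
  by rewrite /v tE exprS; have := at_le i; have := half_expr_gt0 i; lra.
have vmono : nondecreasing_seq v by apply/nondecreasing_seqP.
have vM : has_ubound (range v).
  exists M => _ [i _ <-]; rewrite (le_trans _ (tM i))// /v gerBl.
  by rewrite !mulr_ge0// ltW// half_expr_gt0.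
have vl := nondecreasing_cvgn vmono vM.
set l := sup _ in vl; exists l; last first.
  by apply: (le_trans _ (ub_le_sup vM _ : v 0%N <= l)); [rewrite /v expr0 mulr1|exists 0%N].
have tl : t i @[i --> \oo] --> l.
  have -> : t = (fun i => v i + 4 * kappa * 2^-1 ^+ i).
    by apply/funext => i; rewrite /v subrK.
  rewrite -[l]addr0; apply: cvgD => //.
  rewrite -(mulr0 (4 * kappa)); apply: cvgM; [exact: cvg_cst|exact: cvg_half_expr].
have -> : a = (fun i => 2 * t i - t i.+1) by apply/funext => i; rewrite tE; ring.
have -> : l = 2 * l - l by ring.
apply: cvgB; first by apply: cvgM; [exact: cvg_cst|exact: tl].
by rewrite (cvg_shiftS t).
Qed.

End real_sequences.

Section james.
Variables (R : realType) (E : normedModType R) (x : nat -> E) (theta : R).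
Hypothesis x1 : forall m, `|x m| <= 1.
Implicit Types (f h : dual E) (G : nat -> dual E).

(** The functionals that the points [x m] keep seeing form a convex set; with
    the second condition of [admissible] they stay [theta] away from the late
    terms of [G], see [gap_ge]. *)
Definition detecting f :=
  `|f| <= 1 /\ \forall m \near \oo, 2 * theta <= pairing f (x m).

(** The weak-star closed convex hull of [G n, G n.+1, ...], expressed by the
    half-spaces that contain it. *)
Definition tail_hull G n h := forall y c,
  (forall j, (n <= j)%N -> c <= pairing (G j) y) -> c <= pairing h y.

Definition admissible G := (forall k, detecting (G k)) /\
  forall m, \forall k \near \oo, pairing (G k) (x m) <= theta.

Definition block G' G := forall k, tail_hull G k (G' k).

(** The supremum over the unit ball of [f - liminf G] is at most [c]. *)
Definition gap_le f G c := forall y, `|y| <= 1 -> forall e : R, 0 < e ->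
  \forall k \near \oo, pairing f y - pairing (G k) y <= c + e.

Lemma tail_hull_upper G n h y c : tail_hull G n h ->
  (forall j, (n <= j)%N -> pairing (G j) y <= c) -> pairing h y <= c.
Proof.
move=> Gh Gc; have := Gh (- y) (- c); rewrite pairingNr lerN2; apply.
by move=> j nj; rewrite pairingNr lerN2 Gc.
Qed.

Lemma tail_hull_self G n : tail_hull G n (G n).
Proof. by move=> y c; apply. Qed.

Lemma tail_hull_leq G m n h : (m <= n)%N -> tail_hull G n h -> tail_hull G m h.
Proof.
by move=> mn Gh y c Gc; apply: Gh => j nj; apply: Gc; exact: leq_trans nj.
Qed.

Lemma tail_hull_block G' G n h :
  block G' G -> tail_hull G' n h -> tail_hull G n h.
Proof.
move=> G'G G'h y c Gc; apply: G'h => j nj; apply: G'G => i ji.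
by apply: Gc; exact: leq_trans ji.
Qed.

Lemma tail_hull_mid G n f h : tail_hull G n f -> tail_hull G n h ->
  tail_hull G n (2^-1 *: f + 2^-1 *: h).
Proof.
move=> Gf Gh y c Gc; rewrite pairingDl !pairingZl.
by have := Gf y c Gc; have := Gh y c Gc; lra.
Qed.

Lemma block_trans G'' G' G : block G'' G' -> block G' G -> block G'' G.
Proof. by move=> G''G' G'G k; exact: tail_hull_block (G''G' k). Qed.

Lemma block_refl G : block G G.
Proof. by move=> k; exact: tail_hull_self. Qed.

Lemma detecting_mid f h :
  detecting f -> detecting h -> detecting (2^-1 *: f + 2^-1 *: h).
Proof.
move=> [f1 [N _ fN]] [h1 [M _ hM]]; split.
  apply: dual_norm_le => y y1; rewrite pairingDl !pairingZl.
  by have := pairing_norm_ball f1 y1; have := pairing_norm_ball h1 y1;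
    rewrite !ler_norml; lra.
exists (maxn N M) => // m /=; rewrite geq_max => /andP[Nm Mm].
by rewrite pairingDl !pairingZl; have := fN m Nm; have := hM m Mm; rewrite /=; lra.
Qed.

Lemma admissible_subseq G (phi : nat -> nat) :
  (forall k, (k <= phi k)%N) -> admissible G -> admissible (G \o phi).
Proof.
move=> kphi [GK Gx]; split=> [k|m]; first exact: GK.
have [N _ GN] := Gx m; exists N => // k /= Nk; apply: GN => /=.
exact: leq_trans (kphi k).
Qed.

Lemma block_subseq G G' (phi : nat -> nat) :
  (forall k, (k <= phi k)%N) -> block G' G -> block (G' \o phi) G.
Proof. by move=> kphi G'G k; exact: tail_hull_leq (G'G _). Qed.

Lemma gap_le_subseq f G c (phi : nat -> nat) :
  (forall k, (k <= phi k)%N) -> gap_le f G c -> gap_le f (G \o phi) c.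
Proof.
move=> kphi Gc y y1 e e0; have [N _ GN] := Gc y y1 e e0.
exists N => // k /= Nk; apply: GN => /=; exact: leq_trans (kphi k).
Qed.

Lemma gap_ge f G c : detecting f -> admissible G -> gap_le f G c -> theta <= c.
Proof.
move=> [_ [N _ fN]] [_ Gx] Gc; apply/ler_addgt0Pr => e e0.
have [M1 _ GM1] := Gx N; have [M2 _ GM2] := Gc (x N) (x1 N) e e0.
have := fN N (leqnn N); have := GM1 _ (leq_maxl M1 M2).
by have := GM2 _ (leq_maxr M1 M2); rewrite /=; lra.
Qed.

(** [h] and [G'] almost minimize the gap, which gives the last property.  The
    gap of the pair is then almost reached at some [y], and passing to a
    subsequence of [G'] keeps all later functionals of the construction from
    closing it there. *)
Lemma step_exists (s : dual E) G n (p eps : R) :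
  (forall f, detecting f -> detecting (s + p *: f)) -> admissible G ->
  0 < eps ->
  exists h G' c y,
    [/\ detecting h, tail_hull G n h, admissible G', block G' G &
    [/\ gap_le (s + p *: h) G' c, theta <= c, `|y| <= 1,
        forall k, pairing (G' k) y <= pairing (s + p *: h) y - c + eps &
        forall f G'' c'', detecting f -> tail_hull G n f -> admissible G'' ->
          block G'' G -> gap_le (s + p *: f) G'' c'' -> c - eps <= c'']].
Proof.
move=> sp Gadm eps0.
pose C := [set c | exists f G'', [/\ detecting f, tail_hull G n f,
  admissible G'', block G'' G & gap_le (s + p *: f) G'' c]].
have C_ge c : C c -> theta <= c.
  by move=> [f [G'' [/sp]]] Kf _ Ga _; exact: gap_ge.
have C2 : C 2.
  exists (G n), G; split=> //.
  - exact: Gadm.1.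
  - exact: tail_hull_self.
  - exact: block_refl.
  - move=> y y1 e e0; exists 0%N => // k _ /=.
    have := pairing_norm_ball (sp _ (Gadm.1 n)).1 y1.
    by have := pairing_norm_ball (Gadm.1 k).1 y1; rewrite !ler_norml; lra.
have lbC : has_lbound C by exists theta.
have infC c : C c -> inf C <= c by move=> Cc; apply: ge_inf.
have hC : has_inf C by split; [exists 2|].
have [c Cc c_inf] := inf_adherent (divr_gt0 eps0 (ltr0Sn _ 1)) hC.
have [h [G' [Kh Gh G'adm G'G G'c]]] := Cc.
have [y y1 yP] : exists2 y, `|y| <= 1 & forall N, exists k, (N <= k)%N /\
    pairing (G' k) y <= pairing (s + p *: h) y - c + eps.
  apply: contrapT => ny.
  have /infC : C (c - eps); last by lra.
  exists h, G'; split=> // y y1 e e0; apply: contrapT => nN; apply: ny.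
  exists y => // N; apply: contrapT => nk; apply: nN.
  exists N => // k /= Nk; rewrite leNgt; apply/negP => lt; apply: nk.
  by exists k; split=> //; lra.
have /choice[phi phiP] := yP.
have kphi k : (k <= phi k)%N by have [] := phiP k.
exists h, (G' \o phi), c, y; split=> //.
- exact: admissible_subseq.
- exact: block_subseq.
split=> //; [exact: gap_le_subseq|exact: C_ge|by move=> k; have [] := phiP k|].
move=> f G'' c'' Kf Gf aG'' bG'' gc''.
have /infC : C c'' by exists f, G''.
lra.
Qed.

(** Iteration of [step_exists].  The pair built at stage [n.+1] competes at
    stage [n], because half of the remaining weight on [h n] and half on [h n.+1]
    amount to all of it on their midpoint; whence [c n - eps n <= c n.+1]. *)
Lemma chain_exists (g : nat -> dual E) (eps : nat -> R) :
  admissible g -> (forall n, 0 < eps n) ->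
  exists (s h : nat -> dual E) (G : nat -> nat -> dual E)
      (c : nat -> R) (y : nat -> E), s 0%N = 0 /\ forall n,
    [/\ s n.+1 = s n + 2^-1 ^+ n.+1 *: h n, tail_hull (G n) n (h n),
        block (G n.+1) (G n), detecting (h n) &
    [/\ gap_le (s n + 2^-1 ^+ n *: h n) (G n.+1) (c n), theta <= c n,
        `|y n| <= 1,
        forall k, pairing (G n.+1 k) (y n) <=
          pairing (s n + 2^-1 ^+ n *: h n) (y n) - c n + eps n &
        c n - eps n <= c n.+1]].
Proof.
move=> g_adm eps0.
pose T : Type := (dual E * (nat -> dual E)) * (dual E * R * E).
pose I n (t : T) := (forall f, detecting f ->
  detecting (t.1.1 + 2^-1 ^+ n *: f)) /\ admissible t.1.2.
pose S n (t t' : T) := let s := t.1.1 in let h := t'.2.1.1 in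
  let c := t'.2.1.2 in let y := t'.2.2 in let G := t.1.2 in let G' := t'.1.2 in
  [/\ t'.1.1 = s + 2^-1 ^+ n.+1 *: h, tail_hull G n h, block G' G, detecting h &
    [/\ gap_le (s + 2^-1 ^+ n *: h) G' c, theta <= c, `|y| <= 1,
        forall k, pairing (G' k) y <= pairing (s + 2^-1 ^+ n *: h) y - c + eps n &
        forall f G'' c'', detecting f -> tail_hull G n f -> admissible G'' ->
          block G'' G -> gap_le (s + 2^-1 ^+ n *: f) G'' c'' ->
          c - eps n <= c'']].
(* The weight [2^-n] splits into [2^-(n+1)] on [h] and as much on [f]. *)
have halve (s h f : dual E) n : s + 2^-1 ^+ n.+1 *: h + 2^-1 ^+ n.+1 *: f =
    s + 2^-1 ^+ n *: (2^-1 *: h + 2^-1 *: f).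
  by rewrite scalerDr !scalerA -!exprSr addrA.
have [||u [u0 uI uS]] := @choice_chain T I S ((0, g), (0, 0, 0)).
- by split=> //= f; rewrite expr0 scale1r add0r.
- move=> n [[s G] d] [/= sK Gadm].
  have [h [G' [c [y [Kh Gh G'adm G'G [gc tc y1 yG cmin]]]]]] :=
    step_exists n sK Gadm (eps0 n).
  exists ((s + 2^-1 ^+ n.+1 *: h, G'), (h, c, y)).
    split=> [f Kf|]; last exact: G'adm.
    change (detecting (s + 2^-1 ^+ n.+1 *: h + 2^-1 ^+ n.+1 *: f)).
    by rewrite halve; apply/sK/detecting_mid.
  by split; [reflexivity|exact: Gh|exact: G'G|exact: Kh|
    split; [exact: gc|exact: tc|exact: y1|exact: yG|exact: cmin]].
exists (fun n => (u n).1.1), (fun n => (u n.+1).2.1.1), (fun n => (u n).1.2),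
  (fun n => (u n.+1).2.1.2), (fun n => (u n.+1).2.2).
split=> [|n]; first by rewrite u0.
have [sE Gh bG Kh [gc tc y1 yG cmin]] := uS n.
have [sE' Gh' bG' Kh' [gc' _ _ _ _]] := uS n.+1.
split=> //; split=> //; apply: cmin; last 1 first.
- by move: gc'; rewrite sE halve; exact.
- exact: detecting_mid.
- apply: tail_hull_mid => //; apply: (tail_hull_leq (leqnSn n)).
  exact: tail_hull_block bG Gh'.
- exact: (uI n.+2).2.
- exact: block_trans bG' bG.
Qed.

End james.

Section james_theorem.
Variables (R : realType) (E : normedModType R).

(** The functional is [f - w], with [w] a cluster point of the [h n] and [f] the
    sum of the series [2^-(i+1) h i], obtained here as a cluster point of the
    [F n].  Its norm [beta] is at least every [c m], up to an error, thanks to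
    the points [y n], where [w] is far below [F n].  If [beta] is the value at
    [z], put [a i := h i z - w z]; the gaps bound [F i z - w z] by [c i], which
    bounds [a i], up to an error, by the weighted mean [t i] of
    [a i, a i.+1, ...].  Hence [a] converges to a positive number
    ([cvg_of_halving]), whereas 0 is its limit along the ultrafilter. *)
Theorem james_functional (x : nat -> E) (g : nat -> dual E) (theta : R) :
  0 < theta -> (forall m, `|x m| <= 1) -> (forall k, `|g k| <= 1) ->
  (forall k m, (k <= m)%N -> 2 * theta <= pairing (g k) (x m)) ->
  (forall k m, (m < k)%N -> pairing (g k) (x m) <= theta) ->
  exists f : dual E, forall z, `|z| <= 1 -> pairing f z <> `|f|.
Proof.
move=> theta0 x1 g1 g_ge g_le.
pose q n : R := 2^-1 ^+ n.
have q0 n : 0 < q n := half_expr_gt0 R n.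
have qS n : q n.+1 = q n / 2 by rewrite /q exprS mulrC.
(* With errors [kappa 4^-n] the limit found below is at least
   [theta - 6 kappa = theta / 2]. *)
pose kappa := theta / 12; pose eps n := kappa * q n ^+ 2.
have kappa0 : 0 < kappa by rewrite divr_gt0.
have eps0 n : 0 < eps n by rewrite mulr_gt0// exprn_gt0.
have g_adm : admissible x theta g.
  split=> [k|m]; first by split=> //; exists k => // m /=; exact: g_ge.
  by exists m.+1 => // k /=; exact: g_le.
have [s [h [G [c [y [s0 chain]]]]]] := chain_exists x1 g_adm eps0.
pose F n := s n + q n *: h n.
have sS n z : pairing (s n.+1) z = pairing (s n) z + q n.+1 * pairing (h n) z.
  by have [-> _ _ _ _] := chain n; rewrite pairingDl pairingZl.
have FE n z : pairing (F n) z = pairing (s n) z + q n * pairing (h n) z.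
  by rewrite /F pairingDl pairingZl.
have h1 n : `|h n| <= 1 by have [_ _ _ [h1 _] _] := chain n.
have hz1 n z : `|z| <= 1 -> `|pairing (h n) z| <= 1.
  by move=> z1; exact: pairing_norm_ball.
have G_block m n : (m <= n)%N -> block (G n) (G m).
  elim: n => [|n IHn]; first by rewrite leqn0 => /eqP->; exact: block_refl.
  rewrite leq_eqVlt => /predU1P[->|]; first exact: block_refl.
  rewrite ltnS => /IHn; apply: block_trans; by have [] := chain n.
have h_hull m n : (m <= n)%N -> tail_hull (G m) n (h n).
  by move=> mn; apply: tail_hull_block (G_block _ _ mn) _; have [] := chain n.
have s_dist i n z : (i <= n)%N -> `|z| <= 1 ->
    `|pairing (s n) z - pairing (s i) z| <= q i - q n.
  move=> + z1; elim: n => [|n IHn].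
    by rewrite leqn0 => /eqP->; rewrite !subrr normr0.
  rewrite leq_eqVlt => /predU1P[->|]; first by rewrite !subrr normr0.
  rewrite ltnS => /IHn; have := hz1 n z z1; have := q0 n.
  by rewrite sS qS !ler_norml => qn0 /andP[? ?] /andP[? ?]; apply/andP; split; nra.
have F_dist i n z : (i <= n)%N -> `|z| <= 1 ->
    `|pairing (F n) z - pairing (s i) z| <= q i.
  move=> i_n z1; have := s_dist i n z i_n z1; have := hz1 n z z1; have := q0 n.
  by rewrite FE !ler_norml => qn0 /andP[? ?] /andP[? ?]; apply/andP; split; nra.
have F1 n : `|F n| <= 1.
  apply: dual_norm_le => z z1; apply: le_trans (ler_norm _) _.
  by have := F_dist 0%N n z (leq0n n) z1; rewrite s0 pairing0l subr0 /q expr0.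
have [U UU sU] := ultrafilter_eventually.
have [w w1 hw] := ultralimit_functional UU h1.
have [f f1 Ff] := ultralimit_functional UU F1.
have f_dist i z : `|z| <= 1 -> `|pairing f z - pairing (s i) z| <= q i.
  move=> z1.
  apply: (cvgr_to_le (cvg_norm (cvgB (Ff z) (cvg_cst (pairing (s i) z))))).
  by apply: sU; exists i => // n /= i_n; exact: F_dist.
have w_gap n z : `|z| <= 1 -> pairing (F n) z - pairing w z <= c n.
  move=> z1; apply/ler_addgt0Pr => e e0.
  have [_ _ _ _ [gap _ _ _ _]] := chain n.
  have [N _ GN] := gap z z1 e e0.
  suff : pairing (F n) z - c n - e <= pairing w z by lra.
  apply: (cvgr_to_ge (hw z)); apply: sU; exists (maxn N n.+1) => // j /=.
  rewrite geq_max => /andP[Nj nj]; apply: (h_hull _ _ nj) => k jk.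
  by have := GN k (leq_trans Nj jk); rewrite /F /=; lra.
(* All late [h j] lie in the tail hulls of [G n.+1], which is small at [y n]. *)
have w_y n : pairing w (y n) <= pairing (F n) (y n) - c n + eps n.
  have [_ _ _ _ [_ _ _ Gy _]] := chain n.
  apply: (cvgr_to_le (hw (y n))); apply: sU; exists n.+1 => // j /= nj.
  by apply: (tail_hull_upper (h_hull _ _ nj)) => k _; exact: Gy.
pose beta := `|f - w|.
have c_mono m n : (m <= n)%N -> c m - 2 * eps m <= c n - 2 * eps n.
  elim: n => [|n IHn]; first by rewrite leqn0 => /eqP->.
  rewrite leq_eqVlt => /predU1P[->//|]; rewrite ltnS => /IHn.
  have [_ _ _ _ [_ _ _ _ cS]] := chain n.
  have -> : eps n.+1 = eps n / 4 by rewrite /eps qS; field.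
  by have := eps0 n; lra.
have c_beta m : c m <= beta + 2 * eps m.
  have near_beta n : (m <= n)%N -> c m - 2 * eps m <= beta + 2 * q n.
    move=> mn; have := c_mono m n mn.
    have [_ _ _ _ [_ _ y1 _ _]] := chain n.
    have fwy : pairing f (y n) - pairing w (y n) <= beta.
      rewrite -pairingBl (le_trans (pairing_le _ _))//.
      by rewrite ler_piMr.
    have := f_dist n (y n) y1; have := hz1 n (y n) y1; have := w_y n.
    have := q0 n; have := eps0 n.
    rewrite FE !ler_norml => ? ? ? /andP[? ?] /andP[? ?] ?.
    nra.
  suff : c m - 2 * eps m <= beta by lra.
  apply/ler_addgt0Pr => e e0.
  have [N _ qN] : \forall n \near \oo, `|q n| < e / 2.
    have /cvgr0_norm_lt/(_ (e / 2)) := @cvg_half_expr R.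
    by apply; lra.
  have := near_beta (maxn m N) (leq_maxl _ _).
  have := qN (maxn m N) (leq_maxr _ _); rewrite /= (ger0_norm (ltW (q0 _))); lra.
exists (f - w) => z z1; rewrite -/beta pairingBl => fwz.
pose a i := pairing (h i) z - pairing w z.
(* [t i] is the mean of [a i, a i.+1, ...] with weights [1/2, 1/4, ...]. *)
pose t i := (q i)^-1 * (beta - (pairing (s i) z - (1 - q i) * pairing w z)).
have wz1 : `|pairing w z| <= 1 by exact: pairing_norm_ball.
have qt i : q i * t i = beta - (pairing (s i) z - (1 - q i) * pairing w z).
  by rewrite mulrA mulfV ?gt_eqF// mul1r.
have tS i : t i.+1 = 2 * t i - a i.
  have e : q i.+1 * t i.+1 = q i.+1 * (2 * t i - a i).
    have -> : q i.+1 * (2 * t i - a i) = q i * t i - q i.+1 * a i.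
      by rewrite qS; field.
    by rewrite !qt sS qS /a; field.
  exact: (mulfI (lt0r_neq0 (q0 i.+1)) e).
have [|//|i|i|l al tl] := @cvg_of_halving R a t kappa 2.
- exact: ltW.
- rewrite -(ler_pM2l (q0 i)).
  have -> : q i * (t i + 2 * kappa * 2^-1 ^+ i) =
      q i * t i + 2 * eps i by rewrite /eps /q; ring.
  have := c_beta i; have := w_gap i z z1; rewrite FE qt /a; lra.
- rewrite -(ler_pM2l (q0 i)) qt.
  have := f_dist i z z1; move: wz1; have := q0 i.
  rewrite !ler_norml => ? /andP[? ?] /andP[? ?]; nra.
have : t 0%N = beta.
  by rewrite /t /q expr0 s0 pairing0l; field.
move=> t0; rewrite t0 in tl.
have l0 : l = 0.
  have alU : a i @[i --> U] --> l by apply: cvg_trans al => A; exact: sU.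
  apply: (cvg_unique _ alU) => //.
  rewrite -(subrr (pairing w z)); apply: cvgB; [exact: hw|exact: cvg_cst].
have := c_beta 0%N; have [_ _ _ _ [_ c0 _ _ _]] := chain 0%N.
rewrite /eps /q expr0 /kappa; rewrite l0 in tl; move: tl; rewrite /kappa; lra.
Qed.

End james_theorem.

Theorem james (R : realType) (E : completeNormedModType R) :
  (forall g : dual E, exists x : E, `|x| <= 1 /\ g x = `|g|) ->
  reflexive_space E.
Proof.
move=> attains; apply: contrapT => nrefl.
have [Phi [d [Phi1 d0 Phi_far]]] := not_reflexive_far nrefl.
have [x [g [theta [th0 x1 g1 g_ge g_le]]]] :=
  separating_sequences Phi1 d0 Phi_far.
have [f f_max] := james_functional th0 x1 g1 g_ge g_le.
by have [z [z1 fz]] := attains f; exact: f_max z1 fz.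
Qed.

(** * Weak sequential compactness in reflexive spaces *)

Lemma subseq_cvg_infty (phi : nat -> nat) :
  (forall k, (k <= phi k)%N) -> phi k @[k --> \oo] --> \oo.
Proof.
move=> kphi A [N _ NA]; exists N => // k /= Nk; apply: NA => /=.
exact: leq_trans (kphi k).
Qed.

Section rational_span.
Variables (R : realType) (E : normedModType R) (u : nat -> E).

(** The rational combinations of the [u i] are countable, and [{poly rat}] is a
    ready-made countable type of finitely supported coefficients; their closure
    is nevertheless a real subspace. *)
Definition rat_comb (p : {poly rat}) : E := \sum_(i < size p) ratr p`_i *: u i.

Definition rat_span_closure : set E :=
  [set z | forall e : R, 0 < e -> exists p, `|z - rat_comb p| <= e].

Lemma rat_comb_widen (p : {poly rat}) n : (size p <= n)%N ->
  rat_comb p = \sum_(i < n) ratr p`_i *: u i.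
Proof.
move=> pn; rewrite /rat_comb (big_ord_widen n (fun i => ratr p`_i *: u i))//.
rewrite big_mkcond/=; apply: eq_bigr => i _; case: ltnP => // pi.
by rewrite nth_default// raddf0 scale0r.
Qed.

Lemma rat_combD p q : rat_comb (p + q) = rat_comb p + rat_comb q.
Proof.
pose n := maxn (size p) (size q).
rewrite (@rat_comb_widen p n) ?leq_maxl// (@rat_comb_widen q n) ?leq_maxr//.
rewrite (@rat_comb_widen (p + q) n) ?size_polyD// -big_split/=.
by apply: eq_bigr => i _; rewrite coefD rmorphD scalerDl.
Qed.

Lemma rat_combZ a p : rat_comb (a *: p) = ratr a *: rat_comb p.
Proof.
rewrite (@rat_comb_widen (a *: p) (size p)) ?size_scale_leq// scaler_sumr.
by apply: eq_bigr => i _; rewrite coefZ rmorphM scalerA.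
Qed.

Lemma rat_comb0 : rat_comb 0 = 0.
Proof. by rewrite /rat_comb size_poly0 big_ord0. Qed.

Lemma rat_combXn n : rat_comb 'X^n = u n.
Proof.
rewrite (@rat_comb_widen 'X^n n.+1) ?size_polyXn// big_ord_recr/= big1 => [|i _].
  by rewrite add0r coefXn eqxx rmorph1 scale1r.
by rewrite coefXn lt_eqF ?ltEnat//= raddf0 scale0r.
Qed.

Lemma rat_span_closure_seq n : rat_span_closure (u n).
Proof. by move=> e e0; exists 'X^n; rewrite rat_combXn subrr normr0 ltW. Qed.

Lemma rat_span_closure0 : rat_span_closure 0.
Proof. by move=> e e0; exists 0; rewrite rat_comb0 subrr normr0 ltW. Qed.

Lemma rat_span_closureD z z' :
  rat_span_closure z -> rat_span_closure z' -> rat_span_closure (z + z').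
Proof.
move=> zS z'S e e0; have e2 : 0 < e / 2 by rewrite divr_gt0.
have [p pz] := zS _ e2; have [q qz] := z'S _ e2; exists (p + q).
rewrite rat_combD opprD addrACA (le_trans (ler_normD _ _))//.
by rewrite [leRHS]splitr lerD.
Qed.

Lemma rat_span_closureZ (a : R) z :
  rat_span_closure z -> rat_span_closure (a *: z).
Proof.
move=> zS e e0; have e2 : 0 < e / 2 by rewrite divr_gt0.
have a1 : 0 < `|a| + 1 by rewrite ltr_wpDl.
have [p pz] := zS (e / 2 / (`|a| + 1)) (divr_gt0 e2 a1).
have p1 : 0 < `|rat_comb p| + 1 by rewrite ltr_wpDl.
pose d := e / 2 / (`|rat_comb p| + 1).
have d0 : 0 < d by rewrite divr_gt0.
have [r] : exists r : rat, ratr r \in `]a - d, a + d[.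
  by apply: rat_in_itvoo; lra.
rewrite in_itv/= => /andP[r1 r2].
have ar : `|a - ratr r| <= d by rewrite ler_norml; lra.
exists (r *: p); rewrite rat_combZ.
have -> : a *: z - ratr r *: rat_comb p =
    a *: (z - rat_comb p) + (a - ratr r) *: rat_comb p.
  by rewrite scalerBr scalerBl addrA subrK.
rewrite (le_trans (ler_normD _ _))// !normrZ [leRHS]splitr lerD//.
  rewrite (@le_trans _ _ (`|a| * (e / 2 / (`|a| + 1))))//.
    by rewrite ler_wpM2l.
  rewrite mulrCA; apply: ler_piMr; first exact: ltW.
  by rewrite ler_pdivrMr// mul1r; lra.
rewrite (@le_trans _ _ (d * `|rat_comb p|))//; first by rewrite ler_wpM2r.
by rewrite /d mulrAC ler_pdivrMr// ler_pM2l//; lra.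
Qed.

(** A norm closed subspace is weakly closed, by [separate_subspace]. *)
Lemma rat_span_closure_lim (v : nat -> E) (z : E) (U : set_system nat) :
  ProperFilter U -> (forall n, rat_span_closure (v n)) ->
  (forall g : dual E, pairing g (v n) @[n --> U] --> pairing g z) ->
  rat_span_closure z.
Proof.
move=> UF vS vz; apply: contrapT => nz.
have [e e0 ze] : exists2 e : R, 0 < e & forall p, e < `|z - rat_comb p|.
  apply: contrapT => ne; apply: nz => e e0; apply: contrapT => np; apply: ne.
  exists e => // p; rewrite ltNge; apply/negP => pe; apply: np; by exists p.
have e2 : 0 < e / 2 by rewrite divr_gt0.
have [||||y yS|g gS gz] := @separate_subspace _ _ rat_span_closure z (e / 2).
- exact: rat_span_closure0.
- exact: rat_span_closureD.
- exact: rat_span_closureZ.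
- exact: e2.
- have [p py] := yS _ e2.
  have := ze p; have := ler_normD (z - y) (y - rat_comb p).
  by rewrite addrA subrK; lra.
suff g0 : pairing g z = 0 by rewrite g0 ltxx in gz.
apply: (cvg_unique _ (vz g)) => //.
rewrite (_ : (fun n => _) = (fun=> 0)); first exact: cvg_cst.
by apply/funext => n; rewrite gS.
Qed.

(** One norming functional for each rational combination is enough. *)
Lemma rat_span_closure_separated : exists D : nat -> dual E,
  forall z, rat_span_closure z -> (forall i, pairing (D i) z = 0) -> z = 0.
Proof.
have /choice[g gP] : forall p, exists g : dual E,
    `|g| <= 1 /\ pairing g (rat_comb p) = `|rat_comb p|.
  by move=> p; have [g g1 gp] := norming_functional (rat_comb p); exists g.
exists (fun i => g (odflt 0 (unpickle i))) => z zS gz.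
apply/eqP; rewrite -normr_le0; apply/ler_addgt0Pr => e e0; rewrite add0r.
have [p pz] := zS (e / 2) ltac:(by rewrite divr_gt0).
have [g1 gp] := gP p.
have := gz (pickle p); rewrite pickleK/= => gz0.
have : `|rat_comb p| <= `|z - rat_comb p|.
  rewrite -gp -[pairing _ _]opprK -[- pairing _ _]add0r -gz0 -pairingBr -pairingNr.
  by rewrite (le_trans (pairing_le _ _))// normrN ler_piMl.
have := ler_normD (z - rat_comb p) (rat_comb p); rewrite subrK; lra.
Qed.

End rational_span.

Section weak_compactness.
Variables (R : realType) (E : normedModType R).
Hypothesis reflE : reflexive_space E.

Lemma reflexive_ultralimit (U : set_system nat) (u : nat -> E) (M : R) :
  UltraFilter U -> (forall n, `|u n| <= M) ->
  exists x : E, forall g : dual E, pairing g (u n) @[n --> U] --> pairing g x.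
Proof.
move=> UU uM.
have /choice[J JP] : forall x : E, exists J : dual (dual E),
    (forall g, pairing J g = pairing g x) /\ `|J| <= `|x|.
  by move=> x; have [J ? ?] := bidual_embedding x; exists J.
have [|Phi _ PhiP] := @ultralimit_functional R (dual E) U (J \o u) M UU.
  by move=> n; exact: le_trans (JP _).2 (uM n).
have [x xP] := reflE Phi; exists x => g.
have := PhiP g; rewrite {2}/pairing xP -/(pairing g x).
rewrite (_ : (fun n => _) = (fun n => pairing g (u n)))//.
by apply/funext => n; rewrite /= (JP _).1.
Qed.

(** Let [x] be the weak limit of [u] along an ultrafilter.  A subsequence is
    chosen along which the countable family [D] converges to its values at [x].
    A weak limit [x'] of any further subsequence lies, like [x], in the closed
    span of [u] and agrees with [x] on [D]; so [x' = x], and the subsequence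
    converges weakly. *)
Theorem reflexive_weak_subseq (u : nat -> E) (M : R) :
  (forall n, `|u n| <= M) -> exists (phi : nat -> nat) (x : E),
    (forall k, (k <= phi k)%N) /\ weak_cvg (u \o phi) x.
Proof.
move=> uM; have [U UU sU] := ultrafilter_eventually.
have [D DP] := rat_span_closure_separated u.
have [x ux] := reflexive_ultralimit UU uM.
have near_D k (e : R) : 0 < e -> \forall n \near U,
    forall i, (i < k)%N -> `|pairing (D i) (u n) - pairing (D i) x| < e.
  move=> e0; elim: k => [|k IHk]; first by apply: (@filterE _ U) => n i.
  have Dk : \forall n \near U, `|pairing (D k) (u n) - pairing (D k) x| < e.
    by have /cvgrPdistC_lt/(_ e e0) := ux (D k).
  apply: filterS2 IHk Dk => n nk nD i.
  by rewrite ltnS leq_eqVlt => /predU1P[->|/nk].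
have /choice[phi phiP] : forall k, exists n, (k <= n)%N /\ forall i, (i < k)%N ->
    `|pairing (D i) (u n) - pairing (D i) x| < harmonic k.
  move=> k; have kU : U [set n | (k <= n)%N] by apply: sU; exists k.
  have [n [? ?]] := filter_ex (filterI kU (near_D k _ (harmonic_gt0 k))).
  by exists n.
have kphi k : (k <= phi k)%N by have [] := phiP k.
exists phi, x; split=> // g.
have D_cvg i : pairing (D i) (u (phi k)) @[k --> \oo] --> pairing (D i) x.
  apply/cvgrPdistC_lt => e e0.
  have /cvgr0_norm_lt/(_ e e0)[N _ Ne] := @cvg_harmonic R.
  exists (maxn N i.+1) => // k /=; rewrite geq_max => /andP[Nk ik].
  have [_ /(_ i ik)] := phiP k; have := Ne k Nk.
  by rewrite /= gtr0_norm ?harmonic_gt0// => ? /lt_trans; apply.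
change (pairing g (u (phi n)) @[n --> \oo] --> pairing g x).
apply: contrapT => ncvg.
have [e e0 eP] : exists2 e : R, 0 < e & forall N, exists k, (N <= k)%N /\
    e <= `|pairing g (u (phi k)) - pairing g x|.
  apply: contrapT => ne; apply: ncvg; apply/cvgrPdistC_lt => e e0.
  apply: contrapT => nN; apply: ne; exists e => // N; apply: contrapT => nk.
  apply: nN; exists N => // k /= Nk; rewrite ltNge; apply/negP => ek.
  by apply: nk; exists k.
have /choice[psi psiP] := eP.
have kpsi k : (k <= psi k)%N by have [] := psiP k.
have [x' vx'] := @reflexive_ultralimit U (u \o phi \o psi) M UU (fun n => uM _).
have xx' : x = x'.
  apply/eqP; rewrite -subr_eq0; apply/eqP; apply: DP => [|i].
    rewrite -scaleN1r; apply: rat_span_closureD.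
      apply: (rat_span_closure_lim _ _ ux) => n; exact: rat_span_closure_seq.
    apply: rat_span_closureZ; apply: (rat_span_closure_lim _ _ vx') => n.
    exact: rat_span_closure_seq.
  rewrite pairingBr; apply/eqP; rewrite subr_eq0; apply/eqP.
  apply: (cvg_unique _ _ (vx' (D i))) => //.
  apply: cvg_trans (cvg_comp _ _ (subseq_cvg_infty kpsi) (D_cvg i)).
  by move=> A; exact: sU.
suff : e <= `|pairing g x' - pairing g x| by rewrite xx' subrr normr0 leNgt e0.
apply: (cvgr_to_ge (cvg_norm (cvgB (vx' g) (cvg_cst (pairing g x))))).
by apply: (@filterE _ U) => n /=; have [] := psiP n.
Qed.

End weak_compactness.

(** * Existence of minimizers in reflexive spaces *)

Lemma bounded_setP (R : realType) (V : normedModType R) (A : set V) :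
  bounded_set A <-> exists M : R, forall x, A x -> `|x| <= M.
Proof.
split=> [[M [_ MA]]|[M MA]]; first by exists (M + 1); apply: MA; rewrite ltrDl.
by exists M; split; [exact: num_real|move=> y /ltW My x /MA /le_trans; exact].
Qed.

Lemma le_limn_einf (R : realType) (u v : nat -> \bar R) :
  (forall n, u n <= v n)%E -> (limn_einf u <= limn_einf v)%E.
Proof.
move=> uv; rewrite !limn_einf_lim.
apply: lee_lim; [exact: is_cvg_einfs|exact: is_cvg_einfs|].
apply: nearW => n; apply: le_ereal_inf_tmp => _ [m /= nm <-].
by apply: le_trans (uv m); apply: ereal_inf_lbound; exists m.
Qed.

Lemma EFin_cvg (R : realType) (f : nat -> R) (l : R) :
  f n @[n --> \oo] --> l -> (f n)%:E @[n --> \oo] --> l%:E.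
Proof. by move=> fl; apply: cvg_EFin => //; exact: nearW. Qed.

Section existence_of_minimizers.
Variables (R : realType) (E : normedModType R).
Hypothesis reflE : reflexive_space E.
Implicit Types (A : set E) (f : E -> \bar R).

Lemma bounded_minimizing_attains A f (u : nat -> E) (M : R) :
  seq_weakly_closed A -> swlsc_on A f -> (forall n, A (u n)) ->
  (f \o u) n @[n --> \oo] --> ereal_inf (f @` A) ->
  (forall n, `|u n| <= M) -> attains_inf_on A f.
Proof.
move=> Aclosed flsc Au fu uM.
have [phi [x [kphi ux]]] := reflexive_weak_subseq reflE uM.
have Ax : A x by apply: Aclosed ux => n; exact: Au.
exists x => //; apply/eqP; rewrite eq_le; apply/andP; split; last first.
  by apply: ereal_inf_lbound; exists x.
have := flsc _ _ Ax (fun n => Au (phi n)) ux.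
have fuphi := cvg_comp _ _ (subseq_cvg_infty kphi) fu.
by rewrite (cvg_limn_einf_sup fuphi).1.
Qed.

(** The growth condition holds vacuously when [A] is bounded, so bounded and
    unbounded domains are treated together. *)
Theorem coercive_attains A f :
  seq_weakly_closed A -> proper_on A f -> swlsc_on A f ->
  (forall M : R, exists r : R, forall x, A x -> r <= `|x| -> (M%:E <= f x)%E) ->
  attains_inf_on A f.
Proof.
move=> Aclosed [fNy [x0 Ax0 fx0]] flsc fcoer.
have [v vA v_cvg] : {v : nat -> \bar R | forall i, (f @` A) (v i) &
    v @ \oo --> ereal_inf (f @` A)}.
  by apply: ereal_inf_seq; apply/set0P; exists (f x0), x0.
have /choice[u uP] : forall n, exists x, A x /\ f x = v n.
  by move=> n; have [x Ax fx] := vA n; exists x.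
have fuv : f \o u = v by apply/funext => n; exact: (uP n).2.
pose M : R := fine (f x0) + 1.
have fx0E : f x0 = (fine (f x0))%:E by rewrite fineK// fin_real// fNy.
have infM : (ereal_inf (f @` A) < M%:E)%E.
  apply: (@le_lt_trans _ _ (f x0)); first by apply: ereal_inf_lbound; exists x0.
  by rewrite fx0E lte_fin /M ltrDl.
have [r rP] := fcoer M.
have [N _ vN] : \forall n \near \oo, (v n < M%:E)%E.
  exact: v_cvg _ (open_ereal_lt' infM).
apply: (@bounded_minimizing_attains A f (fun n => u (n + N)%N) r) => //.
- by move=> n; exact: (uP _).1.
- rewrite (_ : _ \o _ = (fun n => v (n + N)%N)); last first.
    by apply/funext => n; rewrite -fuv.
  by rewrite (cvg_shiftn N v).
- move=> n; rewrite leNgt; apply/negP => /ltW ru.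
  have := rP _ (uP (n + N)%N).1 ru; rewrite (uP _).2 leNgt vN//=.
  exact: leq_addl.
Qed.

End existence_of_minimizers.

(** * Test functions detecting norm attainment *)

Section penalized_functional.
Variables (R : realType) (E : normedModType R) (g : dual E).

(** The slope [`|g| + 1] of the penalty exceeds the norm of [g], so that leaving
    the unit ball does not pay. *)
Definition penalized (x : E) : R :=
  - pairing g x + (`|g| + 1) * Num.max (`|x| - 1) 0.

Lemma penalized_in_ball x : `|x| <= 1 -> penalized x = - pairing g x.
Proof. by move=> x1; rewrite /penalized max_r ?subr_le0// mulr0 addr0. Qed.

Lemma penalized_out_ball x : 1 <= `|x| ->
  penalized x = - pairing g x + (`|g| + 1) * (`|x| - 1).
Proof. by move=> x1; rewrite /penalized max_l// subr_ge0. Qed.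

Lemma penalized_ge x : `|x| - 1 - `|g| <= penalized x.
Proof.
have := pairing_le g x; have := normr_ge0 g; have := normr_ge0 x.
have [x1|/ltW x1] := leP `|x| 1.
  by rewrite penalized_in_ball//; nra.
by rewrite penalized_out_ball//; nra.
Qed.

(** The minorant that touches at [x] replaces the norm in the penalty by a
    norming functional of [x]. *)
Lemma penalized_affine_minorant x : exists (k : dual E) (b : R),
  penalized x = pairing k x + b /\ forall y, pairing k y + b <= penalized y.
Proof.
have g1 : 0 <= `|g| + 1 by rewrite addr_ge0.
have [x1|/ltW x1] := leP `|x| 1.
  exists (- g), 0; rewrite pairingNl addr0 penalized_in_ball//; split=> // y.
  by rewrite pairingNl addr0 lerDl mulr_ge0// le_max lexx orbT.
have [h h1 hx] := norming_functional x.
exists (- g + (`|g| + 1) *: h), (- (`|g| + 1)); split.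
  by rewrite penalized_out_ball// pairingDl pairingNl pairingZl hx; ring.
move=> y; rewrite pairingDl pairingNl pairingZl /penalized -addrA lerD2l.
rewrite -[X in _ - X]mulr1 -mulrBr ler_wpM2l// le_max lerD2r.
by rewrite (le_trans (pairing_le _ _))// ler_piMl.
Qed.

Lemma penalized_swlsc A : swlsc_on A (EFin \o penalized).
Proof.
move=> u x _ _ ux; have [k [b [xE kb]]] := penalized_affine_minorant x.
have ku : pairing k (u n) + b @[n --> \oo] --> pairing k x + b.
  by apply: cvgD; [exact: (ux k)|exact: cvg_cst].
rewrite /= xE -(cvg_limn_einf_sup (EFin_cvg ku)).1.
  by apply: le_limn_einf => n; rewrite /= lee_fin.
Qed.

Lemma penalized_coercive (A : set E) (M : R) :
  exists r : R, forall x, A x -> r <= `|x| -> (M%:E <= (EFin \o penalized) x)%E.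
Proof.
exists (M + 1 + `|g|) => x _ rx; rewrite lee_fin.
by have := penalized_ge x; lra.
Qed.

Lemma penalized_lipschitz x y :
  `|penalized x - penalized y| <= (2 * `|g| + 1) * `|x - y|.
Proof.
have max_lip : `|Num.max (`|x| - 1) 0 - Num.max (`|y| - 1) 0| <= `|x - y|.
  have := ler_dist_dist x y; rewrite !ler_norml => /andP[h1 h2].
  by case: (leP (`|x| - 1) 0); case: (leP (`|y| - 1) 0) => ? ?;
    apply/andP; split; lra.
have -> : penalized x - penalized y = - pairing g (x - y) +
    (`|g| + 1) * (Num.max (`|x| - 1) 0 - Num.max (`|y| - 1) 0).
  by rewrite /penalized pairingBr; ring.
rewrite (le_trans (ler_normD _ _))// normrN normrM.
rewrite (ger0_norm (_ : 0 <= `|g| + 1)) ?addr_ge0//.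
have := pairing_norm_le g (x - y); have := normr_ge0 g; nra.
Qed.

Lemma penalized_attains (A : set E) : (forall x, `|x| <= 1 -> A x) ->
  attains_inf_on A (EFin \o penalized) -> exists x, `|x| <= 1 /\ g x = `|g|.
Proof.
move=> ballA [x Ax fx].
have x_min y : `|y| <= 1 -> penalized x <= - pairing g y.
  move=> y1; rewrite -penalized_in_ball// -lee_fin.
  rewrite -[leLHS]/((EFin \o penalized) x) fx; apply: ereal_inf_lbound.
  by exists y => //; exact: ballA.
have g_le : `|g| <= - penalized x.
  by apply: dual_norm_le => y /x_min; rewrite lerNr.
have x1 : `|x| <= 1 by have := penalized_ge x; lra.
exists x; split=> //; change (pairing g x = `|g|).
apply/eqP; rewrite eq_le; apply/andP; split.
  by rewrite (le_trans (pairing_le _ _))// ler_piMr.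
by rewrite penalized_in_ball in g_le => //; lra.
Qed.

(** Scaling points where [g] is large brings [g] exactly to
    [`|g| * (1 - 2^-n)], which makes the sequence of values monotone. *)
Lemma penalized_minimizing_seq : exists2 u : nat -> E,
  minimizing_seq_on setT (EFin \o penalized) u & bounded_set (range u).
Proof.
have /choice[u uP] : forall n : nat, exists x : E, `|x| <= 1 /\
    pairing g x = `|g| * (1 - 2^-1 ^+ n).
  move=> n.
  have q1 : (2^-1 : R) ^+ n <= 1 by rewrite exprn_ile1// invr_le1// ?ler1n ?unitfE.
  have q0 := half_expr_gt0 R n.
  have [g0|gn0] := eqVneq `|g| 0.
    by exists 0; rewrite normr0 pairing0r g0 mul0r.
  have gp : 0 < `|g| by rewrite lt_neqAle eq_sym gn0 normr_ge0.
  have lt : `|g| * (1 - 2^-1 ^+ n) < `|g| by nra.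
  have [x x1 gx] := dual_norm_sup lt.
  have gx0 : 0 < pairing g x by apply: le_lt_trans gx; nra.
  exists ((`|g| * (1 - 2^-1 ^+ n) / pairing g x) *: x); split; last first.
    by rewrite pairingZr divfK// gt_eqF.
  rewrite normrZ ger0_norm; last by rewrite divr_ge0 ?(ltW gx0)//; nra.
  rewrite -[leRHS]mulr1 ler_pM// ?divr_ge0 ?(ltW gx0)//; first by nra.
  by rewrite ler_pdivrMr// mul1r ltW.
have fuE n : penalized (u n) = - `|g| + `|g| * 2^-1 ^+ n.
  by have [u1 gu] := uP n; rewrite penalized_in_ball// gu; ring.
have fu_cvg : penalized (u n) @[n --> \oo] --> - `|g|.
  rewrite (_ : (fun n => _) = (fun n => - `|g| + `|g| * 2^-1 ^+ n)); last first.
    by apply/funext.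
  rewrite -[X in _ --> X]addr0 -[X in _ --> _ + X](mulr0 `|g|).
  by apply: cvgD; [exact: cvg_cst|apply: cvgM; [exact: cvg_cst|exact: cvg_half_expr]].
have penalized_lb x : - `|g| <= penalized x.
  have [x1|/ltW x1] := leP `|x| 1; last by have := penalized_ge x; lra.
  by rewrite penalized_in_ball// lerN2 (le_trans (pairing_le _ _))// ler_piMr.
have infE : ereal_inf ((EFin \o penalized) @` setT) = (- `|g|)%:E.
  apply/eqP; rewrite eq_le; apply/andP; split.
    apply: (cvge_to_ge (EFin_cvg fu_cvg)).
    by apply: nearW => n; apply: ereal_inf_lbound; exists (u n).
  by apply: le_ereal_inf_tmp => _ [x _ <-]; rewrite lee_fin.
exists u; last by apply/bounded_setP; exists 1 => _ [n _ <-]; case: (uP n).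
split=> //.
  apply/nonincreasing_seqP => n; rewrite /= lee_fin !fuE lerD2l.
  by rewrite ler_wpM2l// exprS ler_piMl// ?invf_le1// ?ler1n// ltW// half_expr_gt0.
by rewrite infE; exact: (EFin_cvg fu_cvg).
Qed.

End penalized_functional.
Section test_conditions.
Variables (R : realType) (E : completeNormedModType R).

(** Only the zero space is bounded, and there every functional attains its norm
    at 0: this covers the items about unbounded domains, void in that case. *)
Lemma unbounded_space_attains (g : dual E) :
  (~ bounded_set [set: E] -> exists x : E, `|x| <= 1 /\ g x = `|g|) ->
  exists x : E, `|x| <= 1 /\ g x = `|g|.
Proof.
have [bE _|nbE] := pselect (bounded_set [set: E]); last exact.
have /bounded_setP[M ME] := bE.
have E0 (x : E) : x = 0.
  apply/eqP; apply: contrapT => /negP x0.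
  have nx : 0 < `|x| by rewrite normr_gt0.
  have := ME (((`|M| + 1) / `|x|) *: x) I.
  rewrite normrZ ger0_norm ?divr_ge0 ?addr_ge0// divfK ?gt_eqF//.
  by have := ler_norm M; lra.
exists 0; rewrite normr0; split=> //.
change (pairing g 0 = `|g|); rewrite pairing0r; apply/esym/eqP.
by rewrite -normr_le0 normr_id; apply: dual_norm_le => x _; rewrite (E0 x) pairing0r.
Qed.

Lemma seq_weakly_closed_unit_ball : seq_weakly_closed [set x : E | `|x| <= 1].
Proof.
move=> u x u1 ux; have [h h1 hx] := norming_functional x; rewrite /= -hx.
apply: (cvgr_to_le (ux h)); apply: nearW => n.
rewrite -/(pairing h (u n)) (le_trans (ler_norm _))// pairing_norm_ball//.
exact: u1.
Qed.

Lemma penalized_proper (g : dual E) (A : set E) :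
  A !=set0 -> proper_on A (EFin \o penalized g).
Proof. by move=> [x Ax]; split=> [y _|]; [exact: ltNyr|exists x => //; exact: ltry]. Qed.

Lemma lipschitz_bounded_on (f : E -> R) (A : set E) :
  lipschitz f -> bounded_on A f.
Proof.
move=> [k [_ kP]] D _ /bounded_setP[M DM]; apply/bounded_setP.
pose K := `|k| + 1.
have Klip x y : `|f x - f y| <= K * `|x - y|.
  apply: (kP K _ (x, y)) => //.
  by rewrite /K; have := ler_norm k; lra.
exists (`|f 0| + K * `|M|) => _ [x Dx <-].
have := Klip x 0; have := ler_normD (f x - f 0) (f 0); rewrite subrK subr0.
have : K * `|x| <= K * `|M|.
  by rewrite ler_wpM2l ?addr_ge0// (le_trans (DM _ Dx))// ler_norm.
lra.
Qed.

Lemma lipschitz_penalized (g : dual E) : lipschitz (penalized g).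
Proof.
exists (2 * `|g| + 1); split; first exact: num_real.
move=> M /ltW gM [x y] _ /=; apply: le_trans (penalized_lipschitz g x y) _.
by rewrite ler_wpM2r.
Qed.

End test_conditions.

(** * The equivalence *)

Theorem theorem1p8 (R : realType) (E : completeNormedModType R) :
  [<->
    (* (1) *)
    reflexive_space E;
    (* (2) *)
    forall f : E -> \bar R,
      proper_on setT f -> swlsc_on setT f ->
      (exists2 u : nat -> E, minimizing_seq_on setT f u &
                             bounded_set (range u)) ->
      attains_inf_on setT f;
    (* (3) *)
    forall (A : set E) (f : E -> \bar R),
      bounded_set A -> A !=set0 -> seq_weakly_closed A ->
      proper_on A f -> swlsc_on A f ->
      attains_inf_on A f;
    (* (4) *)
    forall (A : set E) (f : E -> \bar R),
      ~ bounded_set A -> seq_weakly_closed A ->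
      proper_on A f -> swlsc_on A f -> coercive_on A f ->
      attains_inf_on A f;
    (* (5) *)
    forall (A : set E) (f : E -> R),
      ~ bounded_set A -> seq_weakly_closed A ->
      swlsc_on A (EFin \o f) -> coercive_on A (EFin \o f) ->
      attains_inf_on A (EFin \o f);
    (* (6) *)
    forall f : E -> \bar R,
      proper_on setT f -> swlsc_on setT f ->
      (exists (beta : R) (phi : R -> R),
        [/\ forall t, 0 <= t -> 0 <= phi t,
            forall s t, 0 <= s -> s <= t -> phi s <= phi t,
            phi t @[t --> +oo] --> +oo &
            forall x : E, ((phi `|x| + beta)%:E <= f x)%E]) ->
      attains_inf_on setT f;
    (* (7) *)
    forall (A : set E) (f : E -> R),
      ~ bounded_set A -> seq_weakly_closed A ->
      swlsc_on A (EFin \o f) -> bounded_on A f -> coercive_on A (EFin \o f) ->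
      attains_inf_on A (EFin \o f);
    (* (8) *)
    forall f : E -> R,
      swlsc_on setT (EFin \o f) -> coercive_on setT (EFin \o f) ->
      lipschitz f ->
      attains_inf_on setT (EFin \o f);
    (* (9) *)
    forall g : dual E, exists x0 : E, `|x0| <= 1 /\ g x0 = `|g| ].
Proof.
have setT_closed : seq_weakly_closed [set: E] by [].
have setT0 : [set: E] !=set0 by exists 0.
tfae.
- move=> refl f _ flsc [u [_ _ fu] /bounded_setP[M uM]].
  by apply: (bounded_minimizing_attains refl setT_closed flsc _ fu) => // n;
    apply: uM; exists n.
- move=> H2; have refl : reflexive_space E.
    apply: james => g; apply: (@penalized_attains _ _ _ setT) => //.
    apply: H2; [exact: penalized_proper|exact: penalized_swlsc|].
    exact: penalized_minimizing_seq.
  move=> A f /bounded_setP[M AM] _ Aclosed fprop flsc.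
  apply: (coercive_attains refl Aclosed fprop flsc) => c.
  by exists (M + 1) => x /AM xM Mx; exfalso; lra.
- move=> H3; have refl : reflexive_space E.
    apply: james => g; apply: (@penalized_attains _ _ _ [set x | `|x| <= 1]) => //.
    apply: H3; [by apply/bounded_setP; exists 1| |
      exact: seq_weakly_closed_unit_ball| |exact: penalized_swlsc].
      by exists 0; rewrite /= normr0.
    by apply: penalized_proper; exists 0; rewrite /= normr0.
  move=> A f _ Aclosed fprop flsc [_ fcoer].
  exact: (coercive_attains refl Aclosed fprop flsc).
- move=> H4 A f nbA Aclosed flsc fcoer; apply: H4 => //.
  have [x Ax] : A !=set0.
    apply/set0P/eqP => A0; apply: nbA; rewrite A0.
    by apply/bounded_setP; exists 0.
  by split=> [y _|]; [exact: ltNyr|exists x => //; exact: ltry].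
- move=> H5; have refl : reflexive_space E.
    apply: james => g; apply: unbounded_space_attains => nbE.
    apply: (@penalized_attains _ _ _ setT) => //.
    apply: H5 => //; first exact: penalized_swlsc.
    by split=> // M; exact: penalized_coercive.
  move=> f fprop flsc [beta [phi [_ _ phi_cvg phi_le]]].
  apply: (coercive_attains refl setT_closed fprop flsc) => M.
  have /cvgryPge/(_ (M - beta))[r [_ rP]] := phi_cvg.
  exists (r + 1) => x _ rx; apply: le_trans (phi_le x).
  by rewrite lee_fin -lerBlDr; apply: rP; lra.
- move=> H6; have refl : reflexive_space E.
    apply: james => g; apply: (@penalized_attains _ _ _ setT) => //.
    apply: H6; [exact: penalized_proper|exact: penalized_swlsc|].
    exists (- 1 - `|g|), id; split=> // x.
    by rewrite lee_fin; have := penalized_ge g x; lra.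
  move=> A f nbA Aclosed flsc _ [_ fcoer].
  have [x Ax] : A !=set0.
    apply/set0P/eqP => A0; apply: nbA; rewrite A0.
    by apply/bounded_setP; exists 0.
  apply: (coercive_attains refl Aclosed _ flsc) => //.
  by split=> [y _|]; [exact: ltNyr|exists x => //; exact: ltry].
- move=> H7 f flsc fcoer flip; apply: H7 => //; first exact: fcoer.1.
  exact: lipschitz_bounded_on.
- move=> H8 g; apply: unbounded_space_attains => nbE.
  apply: (@penalized_attains _ _ _ setT) => //.
  apply: H8; [exact: penalized_swlsc| |exact: lipschitz_penalized].
  by split=> // M; exact: penalized_coercive.
- exact: james.
Qed.
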